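(* $Q_4$ is a free $R$-module of rank $264$, and $\mathcal{B}_{(2)}$ is an $R$-basis of it.
   Context: $R=\mathbb{Z}[a^{\pm1},b^{\pm1},c^{\pm1}]$. $B_n$ is the braid group with Artin generators $s_1,\dots,s_{n-1}$. For $n\ge 3$, $Q_n$ is the quotient of $RB_n$ by the relations $(s_1-a)(s_1-b)(s_1-c)=0$ and $$s_1^{-1}s_2s_1 = s_1 s_2 s_1^{-1} - a^{-1} s_1 s_2 + a s_1 s_2^{-1} + a s_1^{-1}s_2 - a^3 s_1^{-1} s_2^{-1}+ a^{-1} s_2 s_1 - a s_2 s_1^{-1} - a s_2^{-1} s_1 + a^3 s_2^{-1}s_1^{-1} + a^2 s_1^{-1} s_2^{-1} s_1- a^2 s_1 s_2^{-1} s_1^{-1}.$$ Word convention: $i$ and $\bar i$ stand for $s_i$ and $s_i^{-1}$, $\emptyset$ for $1$, and concatenation is the product. For sets of elements $X,Y$, $X\times Y$ stands for the family of products $xy$, $x\in X,y\in Y$. It is known that $Q_3$ is a free $R$-module of rank $20$; let $\mathcal{B}_{(0)}$ be (the image in $Q_4$ of) an $R$-basis of $Q_3$. Let $E = \{ \emptyset, 2, \bar{2}, 12, 1\bar{2}, \bar{1}2, \bar{1}\bar{2}, 2\bar{1}2 \}$, $F_2 = \{ 3, \bar{3}, 32,3\bar{2}, \bar{3} 2, 321, \bar{3}21, 32\bar{1},3\bar{2}1 \}$, $E_0 =\{ \emptyset, 1 ,\bar{1},2,\bar{2} \}$, $E' = \{ \emptyset, 1, \bar{1},21,2 \bar{1},\bar{2}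 1, \bar{2}\bar{1}, 1 \bar{2} 1 \}$, $$\mathcal{B}_{(1)} = \mathcal{B}_{(0)} \sqcup \mathcal{B}_{(0)} \times F_2 \sqcup E' \times \{ \bar{3}\bar{2}, \bar{3}\bar{2} 1 \} \sqcup E_0 \times \{ \bar{3}2\bar{1} \} \sqcup E \times \{ 3 \bar{2}\bar{1},32\bar{1}2 \}\sqcup \{ \bar{3}\bar{2}\bar{1}, \bar{3} 2 \bar{1} 2 \}$$ (a family of 239 elements). $\mathcal{B}_{(2)}$ is the family of 264 elements obtained by adding to $\mathcal{B}_{(1)}$ the following 25 elements: $3\bar23$, $13\bar23$, $\bar13\bar23$, $213\bar23$, $2\bar13\bar23$, $\bar213\bar23$, $\bar2\bar13\bar23$, $3\bar231$, $3\bar23\bar1$, $3\bar2312$, $3\bar231\bar2$, $3\bar23\bar12$, $3\bar23\bar1\bar2$, $213\bar231$, $\bar213\bar231$, $13\bar2312$, $13\bar231\bar2$, $13\bar23\bar1$, $13\bar231$, $213\bar2312$, $213\bar231\bar2$, $32\bar123$, $\bar3\bar21\bar2\bar3$, $3\bar231\bar21$, $1\bar213\bar23$. *)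

(* Defs.v *)
From HB Require Import structures.
From mathcomp Require Import all_boot all_order all_algebra.
From mathcomp Require Import finmap boolp.
From mathcomp Require Import monalg.

Set Implicit Arguments.
Unset Strict Implicit.
Unset Printing Implicit Defensive.

Import GRing.Theory.

Local Open Scope ring_scope.

(* [{malg R[G]}] is the R-module of finitely supported functions G -> R, with
   [<< r *g g >>] the function r at g and 0 elsewhere.  multinomials only makes
   it a ring for its own [monomType], which excludes groups; the product below
   is the same convolution product, over a [groupType]. *)

Definition group_ring (R : nzRingType) (G : groupType) : Type := {malg R[G]}.

HB.instance Definition _ (R : nzRingType) (G : groupType) :=
  GRing.Lmodule.copy (group_ring R G) {malg R[G]}.

Section GroupRing.
Variables (R : nzRingType) (G : groupType).
Implicit Types x y z : group_ring R G.

Definition gr_one : group_ring R G := << 1%g >>.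

Definition gr_mul : group_ring R G -> group_ring R G -> group_ring R G :=
  locked (fun x y =>
    \sum_(g <- msupp x) \sum_(h <- msupp y) << x@_g * y@_h *g (g * h)%g >>).

Lemma gr_mulE x y : gr_mul x y =
  \sum_(g <- msupp x) \sum_(h <- msupp y) << x@_g * y@_h *g (g * h)%g >>.
Proof. by unlock gr_mul. Qed.

Lemma gr_mulw (d e : {fset G}) x y :
  (msupp x `<=` d)%fset -> (msupp y `<=` e)%fset ->
  gr_mul x y = \sum_(g <- d) \sum_(h <- e) << x@_g * y@_h *g (g * h)%g >>.
Proof.
move=> led lee; rewrite gr_mulE (big_fset_incl _ led) /=.
  apply/eq_bigr=> g _; apply/big_fset_incl => // h _ /mcoeff_outdom ->.
  by rewrite mulr0 monalgU0.
move=> g _ /mcoeff_outdom xg.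
by rewrite big1 // => h _; rewrite xg mul0r monalgU0.
Qed.

Lemma gr_mul0l : left_zero 0 gr_mul.
Proof. by move=> x; rewrite gr_mulE msupp0 big_seq_fset0. Qed.

Lemma gr_mul0r : right_zero 0 gr_mul.
Proof.
by move=> x; rewrite gr_mulE big1 // => g _; rewrite msupp0 big_seq_fset0.
Qed.

Lemma gr_mulUU (r s : R) (g h : G) :
  gr_mul << r *g g >> << s *g h >> = << r * s *g (g * h)%g >>.
Proof. by rewrite (gr_mulw msuppU_le msuppU_le) !big_seq_fset1 !mcoeffUU. Qed.

Lemma gr_mulDl : left_distributive gr_mul +%R.
Proof.
move=> x y z.
rewrite (gr_mulw (msuppD_le x y) (fsubset_refl _)).
rewrite (gr_mulw (fsubsetUl _ (msupp y)) (fsubset_refl (msupp z))).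
rewrite (gr_mulw (fsubsetUr (msupp x) _) (fsubset_refl (msupp z))).
rewrite -big_split /=; apply/eq_bigr=> g _.
rewrite -big_split /=; apply/eq_bigr=> h _.
by rewrite mcoeffD mulrDl monalgUD.
Qed.

Lemma gr_mulDr : right_distributive gr_mul +%R.
Proof.
move=> x y z.
rewrite (gr_mulw (fsubset_refl _) (msuppD_le y z)).
rewrite (gr_mulw (fsubset_refl (msupp x)) (fsubsetUl _ (msupp z))).
rewrite (gr_mulw (fsubset_refl (msupp x)) (fsubsetUr (msupp y) _)).
rewrite -big_split /=; apply/eq_bigr=> g _.
rewrite -big_split /=; apply/eq_bigr=> h _.
by rewrite mcoeffD mulrDr monalgUD.
Qed.

Lemma gr_mul_suml (I : Type) (s : seq I) (F : I -> group_ring R G) y :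
  gr_mul (\sum_(i <- s) F i) y = \sum_(i <- s) gr_mul (F i) y.
Proof.
exact: (big_morph (gr_mul^~ y) (fun _ _ => gr_mulDl _ _ _) (gr_mul0l _)).
Qed.

Lemma gr_mul_sumr (I : Type) (s : seq I) (F : I -> group_ring R G) x :
  gr_mul x (\sum_(i <- s) F i) = \sum_(i <- s) gr_mul x (F i).
Proof.
exact: (big_morph (gr_mul x) (fun _ _ => gr_mulDr _ _ _) (gr_mul0r _)).
Qed.

Lemma gr_mul1l : left_id gr_one gr_mul.
Proof.
move=> x; rewrite [in LHS](monalgE x) gr_mul_sumr [RHS]monalgE.
by apply/eq_bigr=> g _; rewrite gr_mulUU mul1r mul1g.
Qed.

Lemma gr_mul1r : right_id gr_one gr_mul.
Proof.
move=> x; rewrite [in LHS](monalgE x) gr_mul_suml [RHS]monalgE.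
by apply/eq_bigr=> g _; rewrite gr_mulUU mulr1 mulg1.
Qed.

Lemma gr_mulA : associative gr_mul.
Proof.
move=> x y z.
rewrite (monalgE x) !gr_mul_suml; apply/eq_bigr=> g _.
rewrite (monalgE y) gr_mul_suml !gr_mul_sumr gr_mul_suml; apply/eq_bigr=> h _.
rewrite (monalgE z) !gr_mul_sumr; apply/eq_bigr=> k _.
by rewrite !gr_mulUU mulrA mulgA.
Qed.

Lemma gr_one_neq0 : gr_one != 0.
Proof. by rewrite monalgU_eq0 oner_eq0. Qed.

HB.instance Definition _ := GRing.Zmodule_isNzRing.Build (group_ring R G)
  gr_mulA gr_mul1l gr_mul1r gr_mulDl gr_mulDr gr_one_neq0.

Lemma gr_scaleE (r : R) x : r *: x = (<< r *g 1%g >> : group_ring R G) * x.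
Proof.
rewrite [in RHS](monalgE x) [RHS]gr_mul_sumr; apply/eq_bigr=> g _.
by rewrite gr_mulUU mul1g.
Qed.

Lemma gr_scaleAl (r : R) x y : r *: (x * y) = (r *: x) * y.
Proof. by rewrite !gr_scaleE mulrA. Qed.

HB.instance Definition _ := GRing.Lmodule_isLalgebra.Build R (group_ring R G)
  gr_scaleAl.
End GroupRing.

Section GroupAlgebra.
Variables (R : comNzRingType) (G : groupType).

Lemma gr_scaleAr (r : R) (x y : group_ring R G) : r *: (x * y) = x * (r *: y).
Proof.
rewrite !gr_scaleE; set u : group_ring R G := << r *g 1%g >>.
rewrite !mulrA; suff -> : x * u = u * x by [].
rewrite (monalgE x) [LHS]gr_mul_suml [RHS]gr_mul_sumr; apply/eq_bigr=> g _.
by rewrite !gr_mulUU mul1g mulg1 mulrC.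
Qed.

HB.instance Definition _ := GRing.Lalgebra_isAlgebra.Build R (group_ring R G)
  gr_scaleAr.

Lemma gr_mulC :
  (forall g h : G, g * h = h * g)%g -> commutative (@gr_mul R G).
Proof.
move=> GC x y; rewrite (monalgE x) (monalgE y).
rewrite [LHS]gr_mul_suml [RHS]gr_mul_sumr; apply/eq_bigr=> g _.
rewrite [LHS]gr_mul_sumr [RHS]gr_mul_suml; apply/eq_bigr=> h _.
by rewrite [LHS]gr_mulUU [RHS]gr_mulUU mulrC GC.
Qed.
End GroupAlgebra.

Definition group_ring_map (R : nzRingType) (G H : groupType) (f : G -> H)
    (x : group_ring R G) : group_ring R H :=
  \sum_(g <- msupp x) << x@_g *g f g >>.

Section GroupRingMap.
Variables (R : comNzRingType) (G H : groupType) (f : G -> H).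
Hypothesis fM : {morph f : g h / (g * h)%g >-> (g * h)%g}.
Local Notation F := (@group_ring_map R G H f).

Lemma group_ring_mapw (d : {fset G}) x :
  (msupp x `<=` d)%fset -> F x = \sum_(g <- d) << x@_g *g f g >>.
Proof.
move=> led; rewrite /group_ring_map (big_fset_incl _ led) //=.
by move=> g _ /mcoeff_outdom ->; rewrite monalgU0.
Qed.

Lemma group_ring_mapD x y : F (x + y) = F x + F y.
Proof.
rewrite (group_ring_mapw (msuppD_le x y)).
rewrite (group_ring_mapw (fsubsetUl _ (msupp y))).
rewrite (group_ring_mapw (fsubsetUr (msupp x) _)).
by rewrite -big_split /=; apply/eq_bigr=> g _; rewrite mcoeffD monalgUD.
Qed.

Lemma group_ring_map0 : F 0 = 0.
Proof. by rewrite /group_ring_map msupp0 big_seq_fset0. Qed.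

Lemma group_ring_mapU (r : R) g : F << r *g g >> = << r *g f g >>.
Proof. by rewrite (group_ring_mapw msuppU_le) big_seq_fset1 mcoeffUU. Qed.

Lemma group_ring_map_sum (I : Type) (s : seq I) (E : I -> group_ring R G) :
  F (\sum_(i <- s) E i) = \sum_(i <- s) F (E i).
Proof. exact: (big_morph F group_ring_mapD group_ring_map0). Qed.

Lemma group_ring_mapM x y : F (x * y) = F x * F y.
Proof.
rewrite (monalgE x) [X in F X = _]gr_mul_suml !group_ring_map_sum.
rewrite [RHS]gr_mul_suml; apply/eq_bigr=> g _.
rewrite (monalgE y) [X in F X = _]gr_mul_sumr !group_ring_map_sum.
rewrite [RHS]gr_mul_sumr; apply/eq_bigr=> h _.
by rewrite gr_mulUU !group_ring_mapU gr_mulUU fM.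
Qed.

Lemma group_ring_map1 : F 1 = 1.
Proof.
have f1 : f 1%g = 1%g by apply: (@mulgI _ (f 1%g)); rewrite -fM !mulg1.
by rewrite [LHS]group_ring_mapU f1.
Qed.

Lemma group_ring_mapZ r x : F (r *: x) = r *: F x.
Proof.
rewrite !gr_scaleE group_ring_mapM group_ring_mapU.
by have -> : f 1%g = 1%g by apply: (@mulgI _ (f 1%g)); rewrite -fM !mulg1.
Qed.

Lemma group_ring_mapB x y : F (x - y) = F x - F y.
Proof. by rewrite -scaleN1r group_ring_mapD group_ring_mapZ scaleN1r. Qed.
End GroupRingMap.

(* The Laurent polynomial ring Z[a^{+-1}, b^{+-1}, c^{+-1}] is the group ring
   over Z of the group Z^3 of exponents; [lmon i j k] below is the monomial
   a^i b^j c^k. *)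

Definition mulint : Type := int.
HB.instance Definition _ := Choice.copy mulint int.
HB.instance Definition _ := @isGroup.Build mulint (0 : int)
  (fun x : int => - x) (fun x y : int => x + y) (@addrA int) (@add0r int)
  (@addr0 int) (@addNr int) (@addrN int).

Definition exponent : Type := (mulint * mulint * mulint)%type.
HB.instance Definition _ := Group.copy exponent (mulint * mulint * mulint)%type.

Definition laurent : Type := group_ring int exponent.
HB.instance Definition _ := GRing.NzRing.on laurent.

Lemma laurent_mulC : commutative (@GRing.mul laurent).
Proof.
apply: gr_mulC => -[[g1 g2] g3] [[h1 h2] h3].
by congr (_, _, _); apply: (@addrC int).
Qed.

HB.instance Definition _ :=
  GRing.PzRing_hasCommutativeMul.Build laurent laurent_mulC.

Definition lmon (i j k : int) : laurent := << ((i, j, k) : exponent) >>.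

Lemma lmonM i j k i' j' k' :
  lmon i j k * lmon i' j' k' = lmon (i + i') (j + j') (k + k').
Proof. by rewrite [LHS]gr_mulUU mulr1. Qed.

Definition lau_a : laurent := lmon 1 0 0.
Definition lau_b : laurent := lmon 0 1 0.
Definition lau_c : laurent := lmon 0 0 1.
Definition lau_aV : laurent := lmon (-1) 0 0.

Lemma lau_aK : lau_a * lau_aV = 1.
Proof. by rewrite lmonM. Qed.

(* The letter [(i, true)] stands for the Artin generator s_{i+1} of B_n and
   [(i, false)] for its inverse. *)

Definition braid_word (n : nat) : Type := seq ('I_n.-1 * bool).
HB.instance Definition _ n := Choice.on (braid_word n).

Inductive braid_eqv (n : nat) : braid_word n -> braid_word n -> Prop :=
| BraidRefl u : braid_eqv u u
| BraidSym u v : braid_eqv u v -> braid_eqv v u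
| BraidTrans u v w : braid_eqv u v -> braid_eqv v w -> braid_eqv u w
| BraidCat u u' v v' :
    braid_eqv u u' -> braid_eqv v v' -> braid_eqv (u ++ v) (u' ++ v')
| BraidCancel (i : 'I_n.-1) (e : bool) : braid_eqv [:: (i, e); (i, ~~ e)] [::]
| BraidArtin (i j : 'I_n.-1) : j = i.+1 :> nat ->
    braid_eqv [:: (i, true); (j, true); (i, true)]
              [:: (j, true); (i, true); (j, true)]
| BraidCommute (i j : 'I_n.-1) : (i.+1 < j)%N ->
    braid_eqv [:: (i, true); (j, true)] [:: (j, true); (i, true)].

Section BraidGroup.
Local Open Scope quotient_scope.
Variable n : nat.

Definition braid_eqvb : rel (braid_word n) := fun u v => `[< braid_eqv u v >].

Lemma braid_eqvb_equiv : equiv_class_of braid_eqvb.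
Proof.
split=> [u|u v|v u w]; first by apply/asboolP; constructor.
  by apply/asboolP/asboolP; apply: BraidSym.
by move=> /asboolP uv /asboolP vw; apply/asboolP; apply: BraidTrans vw.
Qed.

Canonical braid_eqvb_equivrel := EquivRelPack braid_eqvb_equiv.

Definition braid_group : Type := {eq_quot braid_eqvb}.
HB.instance Definition _ := Choice.on braid_group.
HB.instance Definition _ := EqQuotient.on braid_group.

Implicit Types u v w : braid_word n.

Lemma braid_piP u v :
  \pi_braid_group u = \pi_braid_group v <-> braid_eqv u v.
Proof. by split=> [/eqmodP/asboolP|?]; last apply/eqmodP/asboolP. Qed.

Lemma braid_repr_pi u : braid_eqv (repr (\pi_braid_group u)) u.
Proof. by apply/braid_piP; rewrite reprK. Qed.

Definition inv_word u : braid_word n := rev [seq (x.1, ~~ x.2) | x <- u].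

Lemma inv_wordV u : braid_eqv (inv_word u ++ u) [::].
Proof.
elim: u => [|[i e] u IH]; first exact: BraidRefl.
rewrite /inv_word /= rev_cons cat_rcons.
rewrite -[_ :: (i, e) :: u]/([:: (i, ~~ e); (i, e)] ++ u).
apply: BraidTrans IH; apply: BraidCat; first exact: BraidRefl.
rewrite -[X in braid_eqv _ X]cat0s; apply: BraidCat; last exact: BraidRefl.
by have := @BraidCancel n i (~~ e); rewrite negbK.
Qed.

Lemma inv_wordK : involutive inv_word.
Proof.
move=> u; rewrite /inv_word map_rev revK -map_comp -[RHS]map_id.
by apply: eq_map => -[i e] /=; rewrite negbK.
Qed.

Lemma inv_word_eqv u v : braid_eqv u v -> braid_eqv (inv_word u) (inv_word v).
Proof.
move=> uv; set w := inv_word u.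
have wvr : braid_eqv (w ++ (v ++ inv_word v)) w.
  rewrite -[X in braid_eqv _ X]cats0; apply: BraidCat; first exact: BraidRefl.
  by rewrite -{1}[v]inv_wordK; apply: inv_wordV.
apply: BraidTrans (BraidSym wvr) _; rewrite catA -[X in braid_eqv _ X]cat0s.
apply: BraidCat; last exact: BraidRefl.
apply: BraidTrans (inv_wordV u); apply: BraidCat; first exact: BraidRefl.
exact: BraidSym.
Qed.

Definition braid_one : braid_group := \pi_braid_group [::].
Definition braid_mul := lift_op2 braid_group cat.
Definition braid_inv := lift_op1 braid_group inv_word.

Lemma braid_mul_pi u v :
  braid_mul (\pi_braid_group u) (\pi_braid_group v) = \pi_braid_group (u ++ v).
Proof.
unlock braid_mul; apply/braid_piP.
by apply: BraidCat; apply: braid_repr_pi.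
Qed.

Lemma braid_inv_pi u :
  braid_inv (\pi_braid_group u) = \pi_braid_group (inv_word u).
Proof.
unlock braid_inv; apply/braid_piP.
by apply: inv_word_eqv; apply: braid_repr_pi.
Qed.

Lemma braid_mulA : associative braid_mul.
Proof.
move=> x y z; rewrite -[x]reprK -[y]reprK -[z]reprK.
by rewrite !braid_mul_pi catA.
Qed.

Lemma braid_mul1 : left_id braid_one braid_mul.
Proof. by move=> x; rewrite -[x]reprK braid_mul_pi. Qed.

Lemma braid_mulr1 : right_id braid_one braid_mul.
Proof. by move=> x; rewrite -[x]reprK braid_mul_pi cats0. Qed.

Lemma braid_mulV : left_inverse braid_one braid_inv braid_mul.
Proof.
move=> x; rewrite -[x]reprK braid_inv_pi braid_mul_pi.
by apply/braid_piP; apply: inv_wordV.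
Qed.

Lemma braid_mulrV : right_inverse braid_one braid_inv braid_mul.
Proof.
move=> x; rewrite -[x]reprK braid_inv_pi braid_mul_pi; apply/braid_piP.
by rewrite -{1}[repr x]inv_wordK; apply: inv_wordV.
Qed.

HB.instance Definition _ := isGroup.Build braid_group
  braid_mulA braid_mul1 braid_mulr1 braid_mulV braid_mulrV.

(* The Artin generator s_i, for 1 <= i < n; it is 1 for i out of range. *)
Definition artin (i : nat) : braid_group :=
  if (0 < i)%N then
    if insub i.-1 is Some k then \pi_braid_group [:: (k, true)] else 1%g
  else 1%g.

(* Words in the generators are lists of integers: i stands for s_i, and -i for
   the inverse of s_i. *)
Definition artin_letter (i : int) : braid_group :=
  if i is Posz k then artin k else ((artin `|i|%N)^-1)%g.

Definition artin_word (w : seq int) : braid_group :=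
  (\prod_(i <- w) artin_letter i)%g.

End BraidGroup.

(* The natural map B_n -> B_{n+1}, sending s_i to s_i for i < n. *)
Definition braid_widen (n : nat) (x : braid_group n) : braid_group n.+1 :=
  (\pi_(braid_group n.+1)
     [seq (widen_ord (leq_pred n) l.1, l.2) | l <- repr x])%qT.

Section BraidWiden.
Local Open Scope quotient_scope.
Variable n : nat.

Local Notation widen_word :=
  (map (fun l => (widen_ord (leq_pred n) l.1, l.2))).

Lemma braid_eqv_widen (u v : braid_word n) :
  braid_eqv u v -> @braid_eqv n.+1 (widen_word u) (widen_word v).
Proof.
elim=> [{}u|{}u {}v _|{}u {}v w _ uv _|{}u u' {}v v' _ uu' _ vv'|||].
- exact: BraidRefl.
- exact: BraidSym.
- exact: BraidTrans.
- by rewrite !map_cat; apply: BraidCat.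
- by move=> i e; apply: BraidCancel.
- by move=> i j ij; apply: BraidArtin.
- by move=> i j ij; apply: BraidCommute.
Qed.

Lemma braid_widen_pi (u : braid_word n) :
  braid_widen (\pi_(braid_group n) u) = \pi_(braid_group n.+1) (widen_word u).
Proof. by apply/braid_piP/braid_eqv_widen/braid_repr_pi. Qed.

Lemma braid_widenM :
  {morph @braid_widen n : x y / (x * y)%g >-> (x * y)%g}.
Proof.
elim/quotW=> u; elim/quotW=> v.
rewrite [(_ * _)%g in LHS]braid_mul_pi !braid_widen_pi map_cat.
by rewrite [RHS]braid_mul_pi.
Qed.

Lemma braid_widen1 : braid_widen (1%g : braid_group n) = 1%g.
Proof. exact: (braid_widen_pi [::]). Qed.

Lemma braid_widenV x : @braid_widen n x^-1%g = ((braid_widen x)^-1)%g.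
Proof.
apply: (@mulgI _ (braid_widen x)).
by rewrite -braid_widenM !mulgV braid_widen1.
Qed.

Lemma braid_widen_artin i : (i < n)%N -> braid_widen (artin n i) = artin n.+1 i.
Proof.
rewrite /artin; case: i => [|i] /= lin; first exact: braid_widen1.
have lin1 : (i < n.-1)%N by case: (n) lin.
rewrite insubT [insub _]insubT ?(leq_trans lin1 (leq_pred n)) // => lin2.
by rewrite braid_widen_pi; congr (\pi_(_) [:: (_, _)]); apply: val_inj.
Qed.

Lemma braid_widen_word (w : seq int) :
  all (fun i => `|i| < n)%N w ->
  braid_widen (artin_word n w) = artin_word n.+1 w.
Proof.
rewrite /artin_word; elim: w => [_|i w IH /= /andP[lin lwn]].
  by rewrite !big_nil braid_widen1.
rewrite !big_cons braid_widenM IH //; congr (_ * _)%g.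
by case: i lin => k lkn /=; rewrite ?braid_widenV braid_widen_artin.
Qed.
End BraidWiden.

Inductive gen_ideal (A : pzRingType) (S : A -> Prop) : A -> Prop :=
| GenIdealIn x : S x -> gen_ideal S x
| GenIdeal0 : gen_ideal S 0
| GenIdealD x y : gen_ideal S x -> gen_ideal S y -> gen_ideal S (x + y)
| GenIdealM u x v : gen_ideal S x -> gen_ideal S (u * x * v).

Section QuotientAlgebra.
Local Open Scope quotient_scope.
Variables (R : comNzRingType) (A : algType R) (S : A -> Prop).

Definition gen_idealb : {pred A} := fun x => `[< gen_ideal S x >].

Lemma gen_idealbP x : reflect (gen_ideal S x) (x \in gen_idealb).
Proof. exact: asboolP. Qed.

Lemma gen_idealb_zmod : zmod_closed gen_idealb.
Proof.
split=> [|x y /gen_idealbP Ix /gen_idealbP Iy]; apply/gen_idealbP.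
  exact: GenIdeal0.
by apply: GenIdealD => //; have := GenIdealM (-1) 1 Iy; rewrite mulr1 mulN1r.
Qed.

HB.instance Definition _ := GRing.isZmodClosed.Build A gen_idealb
  gen_idealb_zmod.

Definition quot_alg : Type := Quotient.quot gen_idealb.
HB.instance Definition _ := GRing.Zmodule.on quot_alg.
HB.instance Definition _ := EqQuotient.on quot_alg.

Lemma quot_algP (x y : A) :
  \pi_quot_alg x = \pi_quot_alg y <-> gen_ideal S (x - y).
Proof.
have := Quotient.idealrBE gen_idealb x y => E.
split=> [/eqP xy|/gen_idealbP xy]; first by apply/gen_idealbP; rewrite E.
by apply/eqP; rewrite -E.
Qed.

Lemma quot_alg_repr (x : A) : gen_ideal S (repr (\pi_quot_alg x) - x).
Proof. by apply/quot_algP; rewrite reprK. Qed.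

Lemma quot_piD x y : \pi_quot_alg (x + y) = \pi_quot_alg x + \pi_quot_alg y.
Proof. by rewrite [RHS]piE. Qed.

Definition quot_one : quot_alg := \pi_quot_alg 1.
Definition quot_mul := lift_op2 quot_alg *%R.
Definition quot_scale (r : R) := lift_op1 quot_alg ( *:%R r).

Lemma quot_mul_pi x y :
  quot_mul (\pi_quot_alg x) (\pi_quot_alg y) = \pi_quot_alg (x * y).
Proof.
unlock quot_mul; apply/quot_algP; set x' := repr _; set y' := repr _.
have -> : x' * y' - x * y = (1 * (x' - x) * y') + (x * (y' - y) * 1).
  by rewrite mul1r mulr1 mulrBl mulrBr addrA subrK.
by apply: GenIdealD; apply: GenIdealM; apply: quot_alg_repr.
Qed.

Lemma quot_scale_pi r x :
  quot_scale r (\pi_quot_alg x) = \pi_quot_alg (r *: x).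
Proof.
rewrite /quot_scale; unlock; apply/quot_algP; rewrite -scalerBr; set d := repr _ - x.
have -> : r *: d = r%:A * d * 1 by rewrite mulr1 -scalerAl mul1r.
by apply: GenIdealM; apply: quot_alg_repr.
Qed.

Lemma quot_mulA : associative quot_mul.
Proof.
move=> x y z; rewrite -[x]reprK -[y]reprK -[z]reprK.
by rewrite !quot_mul_pi mulrA.
Qed.

Lemma quot_mul1 : left_id quot_one quot_mul.
Proof. by move=> x; rewrite -[x]reprK quot_mul_pi mul1r. Qed.

Lemma quot_mulr1 : right_id quot_one quot_mul.
Proof. by move=> x; rewrite -[x]reprK quot_mul_pi mulr1. Qed.

Lemma quot_mulDl : left_distributive quot_mul +%R.
Proof.
move=> x y z; rewrite -[x]reprK -[y]reprK -[z]reprK.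
by rewrite -quot_piD !quot_mul_pi -quot_piD mulrDl.
Qed.

Lemma quot_mulDr : right_distributive quot_mul +%R.
Proof.
move=> x y z; rewrite -[x]reprK -[y]reprK -[z]reprK.
by rewrite -quot_piD !quot_mul_pi -quot_piD mulrDr.
Qed.

HB.instance Definition _ := GRing.Zmodule_isPzRing.Build quot_alg
  quot_mulA quot_mul1 quot_mulr1 quot_mulDl quot_mulDr.

Lemma quot_scaleA r s x : quot_scale r (quot_scale s x) = quot_scale (r * s) x.
Proof. by rewrite -[x]reprK !quot_scale_pi scalerA. Qed.

Lemma quot_scale1 : left_id 1 quot_scale.
Proof. by move=> x; rewrite -[x]reprK quot_scale_pi scale1r. Qed.

Lemma quot_scaleDr : right_distributive quot_scale +%R.
Proof.
move=> r x y; rewrite -[x]reprK -[y]reprK.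
by rewrite -quot_piD !quot_scale_pi -quot_piD scalerDr.
Qed.

Lemma quot_scaleDl x : {morph quot_scale^~ x : r s / r + s}.
Proof.
by move=> r s; rewrite -[x]reprK !quot_scale_pi -quot_piD scalerDl.
Qed.

HB.instance Definition _ := GRing.Zmodule_isLmodule.Build R quot_alg
  quot_scaleA quot_scale1 quot_scaleDr quot_scaleDl.

Lemma quot_scaleAl (r : R) (x y : quot_alg) : r *: (x * y) = (r *: x) * y.
Proof.
rewrite -[x]reprK -[y]reprK; transitivity (\pi_quot_alg (r *: (repr x * repr y))).
  by rewrite -quot_scale_pi -quot_mul_pi.
by rewrite scalerAl -quot_mul_pi -quot_scale_pi.
Qed.

Lemma quot_scaleAr (r : R) (x y : quot_alg) : r *: (x * y) = x * (r *: y).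
Proof.
rewrite -[x]reprK -[y]reprK; transitivity (\pi_quot_alg (r *: (repr x * repr y))).
  by rewrite -quot_scale_pi -quot_mul_pi.
by rewrite scalerAr -quot_mul_pi -quot_scale_pi.
Qed.

End QuotientAlgebra.

Definition RB (n : nat) : Type := group_ring laurent (braid_group n).
HB.instance Definition _ n := GRing.Algebra.on (RB n).

Definition rbw (n : nat) (w : seq int) : RB n := << artin_word n w >>.

Definition cubic_relator (n : nat) : RB n :=
  (rbw n [:: 1]%Z - lau_a%:A) * (rbw n [:: 1]%Z - lau_b%:A)
  * (rbw n [:: 1]%Z - lau_c%:A).

Definition quartic_relator (n : nat) : RB n :=
  let s := rbw n in
  s [:: -1; 2; 1]%Z
  - (s [:: 1; 2; -1]%Z
     - lau_aV *: s [:: 1; 2]%Z + lau_a *: s [:: 1; -2]%Z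
     + lau_a *: s [:: -1; 2]%Z - lau_a ^+ 3 *: s [:: -1; -2]%Z
     + lau_aV *: s [:: 2; 1]%Z - lau_a *: s [:: 2; -1]%Z
     - lau_a *: s [:: -2; 1]%Z + lau_a ^+ 3 *: s [:: -2; -1]%Z
     + lau_a ^+ 2 *: s [:: -1; -2; 1]%Z
     - lau_a ^+ 2 *: s [:: 1; -2; -1]%Z).

Definition Q_relators (n : nat) (x : RB n) : Prop :=
  x = cubic_relator n \/ x = quartic_relator n.

(* Meaningful for 3 <= n only, since the relations involve s_1 and s_2. *)
Definition Q (n : nat) : Type := quot_alg (@Q_relators n).
HB.instance Definition _ n := GRing.PzRing.on (Q n).
HB.instance Definition _ n := GRing.Lmodule.on (Q n).
HB.instance Definition _ n := EqQuotient.on (Q n).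

Definition qw (n : nat) (w : seq int) : Q n := (\pi_(Q n) (rbw n w))%qT.

Definition qws (n : nat) (ws : seq (seq int)) : seq (Q n) :=
  [seq qw n w | w <- ws].

(* The natural map Q_n -> Q_{n+1}, see [Q_widen_pi] and [Q_widen_qw]. *)
Definition Q_widen (n : nat) (x : Q n) : Q n.+1 :=
  (\pi_(Q n.+1) (group_ring_map (@braid_widen n) (repr x)))%qT.

Lemma cubic_morph (R : comNzRingType) (A B : lalgType R) (f : A -> B) :
    {morph f : x y / x - y} -> {morph f : x y / x * y} ->
    (forall r, {morph f : x / r *: x}) -> f 1 = 1 ->
  forall x r s t, f ((x - r%:A) * (x - s%:A) * (x - t%:A)) =
    (f x - r%:A) * (f x - s%:A) * (f x - t%:A).
Proof. by move=> fB fM fZ f1 x r s t; rewrite !fM !fB !fZ f1. Qed.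

Lemma linear_morphB (R : comNzRingType) (A B : lmodType R) (f : A -> B) :
    {morph f : x y / x - y} -> (forall r, {morph f : x / r *: x}) ->
  forall x y r u v, f x = u -> f y = v -> f (x - r *: y) = u - r *: v.
Proof. by move=> fB fZ x y r u v <- <-; rewrite fB fZ. Qed.

Lemma linear_morphD (R : comNzRingType) (A B : lmodType R) (f : A -> B) :
    {morph f : x y / x - y} -> (forall r, {morph f : x / r *: x}) ->
  forall x y r u v, f x = u -> f y = v -> f (x + r *: y) = u + r *: v.
Proof.
move=> fB fZ x y r u v fx fy; have := linear_morphB fB fZ (- r) fx fy.
by rewrite !scaleNr !opprK.
Qed.

Section QWiden.
Variable n : nat.
Hypothesis n_gt2 : (2 < n)%N.
Local Notation F := (group_ring_map (@braid_widen n)).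
Let FM := @group_ring_mapM laurent _ _ _ (@braid_widenM n).
Let FZ := @group_ring_mapZ laurent _ _ _ (@braid_widenM n).
Let FB := @group_ring_mapB laurent _ _ _ (@braid_widenM n).
Let F1 := @group_ring_map1 laurent _ _ _ (@braid_widenM n).

Lemma rbw_widen w : all (fun i : int => `|i| < n)%N w ->
  F (rbw n w) = rbw n.+1 w.
Proof.
by move=> wn; rewrite /rbw [LHS]group_ring_mapU braid_widen_word.
Qed.

Lemma cubic_relator_widen : F (cubic_relator n) = cubic_relator n.+1.
Proof.
have s1 : F (rbw n [:: 1]%Z) = rbw n.+1 [:: 1]%Z.
  by rewrite rbw_widen //= (ltnW n_gt2).
by apply: etrans (cubic_morph FB FM FZ F1 _ _ _ _) _; rewrite s1.
Qed.

Lemma quartic_relator_widen : F (quartic_relator n) = quartic_relator n.+1.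
Proof.
have W w : all (fun i : int => `|i| < 3)%N w -> F (rbw n w) = rbw n.+1 w.
  by move=> w3; apply: rbw_widen; apply: sub_all w3 => i /leq_trans; apply.
have LB := linear_morphB FB FZ.
have LD := linear_morphD FB FZ.
rewrite /quartic_relator.
apply: etrans (FB _ _) _; congr (_ - _); first exact: W.
do 10![(apply: (LB) || apply: (LD)); last exact: W]; exact: W.
Qed.

Lemma gen_ideal_widen (x : RB n) :
  gen_ideal (@Q_relators n) x -> gen_ideal (@Q_relators n.+1) (F x).
Proof.
elim=> [{}x relx||{}x y _ Fx _ Fy|u {}x v _ Fx].
- apply: GenIdealIn; case: relx => ->; [left | right].
    exact: cubic_relator_widen.
  exact: quartic_relator_widen.
- by rewrite group_ring_map0; apply: GenIdeal0.
- by rewrite [X in gen_ideal _ X]group_ring_mapD; apply: GenIdealD.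
- by rewrite [X in gen_ideal _ X]FM [X in X * _]FM; apply: GenIdealM.
Qed.

Lemma Q_widen_pi (x : RB n) :
  Q_widen (\pi_(Q n) x)%qT = (\pi_(Q n.+1) (F x))%qT.
Proof.
by apply/quot_algP; rewrite -FB; apply/gen_ideal_widen/quot_alg_repr.
Qed.

Lemma Q_widen_qw (w : seq int) :
  all (fun i => `|i| < n)%N w -> Q_widen (qw n w) = qw n.+1 w.
Proof. by move=> wn; rewrite Q_widen_pi rbw_widen. Qed.
End QWiden.

Definition is_basis (R : pzRingType) (V : lmodType R) (s : seq V) : Prop :=
  (forall v : V, exists c : 'I_(size s) -> R, v = \sum_i c i *: s`_i) /\
  (forall c : 'I_(size s) -> R, \sum_i c i *: s`_i = 0 -> forall i, c i = 0).

Definition free_of_rank (R : pzRingType) (V : lmodType R) (r : nat) : Prop :=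
  exists s : seq V, size s = r /\ is_basis s.

(* Lists of words, see [artin_word]. *)

Definition famE : seq (seq int) :=
  [:: [::]; [:: 2]; [:: -2]; [:: 1; 2]; [:: 1; -2]; [:: -1; 2]; [:: -1; -2];
      [:: 2; -1; 2]]%Z.

Definition famF2 : seq (seq int) :=
  [:: [:: 3]; [:: -3]; [:: 3; 2]; [:: 3; -2]; [:: -3; 2]; [:: 3; 2; 1];
      [:: -3; 2; 1]; [:: 3; 2; -1]; [:: 3; -2; 1]]%Z.

Definition famE0 : seq (seq int) :=
  [:: [::]; [:: 1]; [:: -1]; [:: 2]; [:: -2]]%Z.

Definition famE' : seq (seq int) :=
  [:: [::]; [:: 1]; [:: -1]; [:: 2; 1]; [:: 2; -1]; [:: -2; 1]; [:: -2; -1];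
      [:: 1; -2; 1]]%Z.

Definition new_words : seq (seq int) :=
  [:: [:: 3; -2; 3]; [:: 1; 3; -2; 3]; [:: -1; 3; -2; 3]; [:: 2; 1; 3; -2; 3];
      [:: 2; -1; 3; -2; 3]; [:: -2; 1; 3; -2; 3]; [:: -2; -1; 3; -2; 3];
      [:: 3; -2; 3; 1]; [:: 3; -2; 3; -1]; [:: 3; -2; 3; 1; 2];
      [:: 3; -2; 3; 1; -2]; [:: 3; -2; 3; -1; 2]; [:: 3; -2; 3; -1; -2];
      [:: 2; 1; 3; -2; 3; 1]; [:: -2; 1; 3; -2; 3; 1];
      [:: 1; 3; -2; 3; 1; 2]; [:: 1; 3; -2; 3; 1; -2];
      [:: 1; 3; -2; 3; -1]; [:: 1; 3; -2; 3; 1];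
      [:: 2; 1; 3; -2; 3; 1; 2]; [:: 2; 1; 3; -2; 3; 1; -2];
      [:: 3; 2; -1; 2; 3]; [:: -3; -2; 1; -2; -3];
      [:: 3; -2; 3; 1; -2; 1]; [:: 1; -2; 1; 3; -2; 3]]%Z.

Definition prods (A : pzRingType) (X Y : seq A) : seq A :=
  [seq x * y | x <- X, y <- Y].

Definition family1 (B0 : seq (Q 3)) : seq (Q 4) :=
  let B := [seq Q_widen x | x <- B0] in
  B ++ prods B (qws 4 famF2)
    ++ prods (qws 4 famE') (qws 4 [:: [:: -3; -2]; [:: -3; -2; 1]]%Z)
    ++ prods (qws 4 famE0) (qws 4 [:: [:: -3; 2; -1]]%Z)
    ++ prods (qws 4 famE) (qws 4 [:: [:: 3; -2; -1]; [:: 3; 2; -1; 2]]%Z)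
    ++ qws 4 [:: [:: -3; -2; -1]; [:: -3; 2; -1; 2]]%Z.

Definition family2 (B0 : seq (Q 3)) : seq (Q 4) :=
  family1 B0 ++ qws 4 new_words.

(* Main.v *)
(* In the scaled generators t_i = s_i / a the relations of Q_4 only involve
   p = (b + c) / a and q = b c / a^2.  A noncommutative Groebner basis
   computation over Z[p, q, 1/q], with leading coefficients that are units,
   yields a rewriting system with exactly 264 normal words.  These words span
   Q_4 because the span is stable under right multiplication by the letters.
   They are independent because the table of normal forms of (normal word) x
   (letter), read as operators on the free module on the normal words,
   satisfies the relations of Q_4: this is the regular representation, which
   sends 1 to w under a normal word w.  Finally, the normal words are obtained
   from the family by triangular elimination, so the family also spans Q_4, and
   264 elements spanning a free module of rank 264 form a basis. *)

From Stdlib Require Import ZArith.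
From HB Require Import structures.
From mathcomp Require Import all_boot all_order all_algebra finmap boolp.
From mathcomp Require Import monalg.
From mathcomp Require Import ring ssrZ.
Require Import Defs.

Set Implicit Arguments.
Unset Strict Implicit.
Unset Printing Implicit Defensive.

Import GRing.Theory.

(** * Computing with words and sparse polynomials *)

(** Dividing the generators by a puts one root of the cubic at 1 and turns the second relation into
    the equality of (t_1^-1 - 1)(t_2 - t_2^-1)(t_1 - 1) with the product in which the outer factors
    are exchanged. Its coefficients are then 1 or -1, so p and q enter through the cubic alone.
    Neither termination nor confluence of the rewriting is proved. A rule only has to be a
    consequence of the relations, which follows from the way it is produced, so the choice of
    critical pairs is untrusted data. Independence, which confluence would ordinarily give, rests on
    the finite check that the tables of the letters satisfy the relations. The basis of Q_3 is
    arbitrary, so the family is not a list of words. Its span nevertheless contains the image of Q_3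
    and the products of that image with F_2, and the elimination uses only words that lie in this
    span. *)

Section Merge.
Variables (K V : Type) (cmp : K -> K -> comparison) (add : V -> V -> V).
Variable is0 : V -> bool.

(** Lists are kept strictly decreasing for [cmp], so that equal keys meet and the head is the
    leading term. Soundness, in [sum_merge], rests only on [cmp] answering [Eq] for equal keys
    alone. *)
Fixpoint merge (s : seq (K * V)) : seq (K * V) -> seq (K * V) :=
  match s with
  | [::] => id
  | (k, x) :: s' => fix merge_s t := match t with
    | [::] => s
    | (l, y) :: t' => match cmp k l with
      | Gt => (k, x) :: merge s' t
      | Lt => (l, y) :: merge_s t'
      | Eq => let z := add x y in
              if is0 z then merge s' t' else (k, z) :: merge s' t'
      end
    end
  end.
End Merge.

Definition coef : Type := seq (nat * Z * Z).

Definition mono_cmp (m n : nat * Z) : comparison :=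
  match Z.compare m.2 n.2 with
  | Eq => Nat.compare m.1 n.1
  | c => c
  end.

Definition cadd : coef -> coef -> coef := merge mono_cmp Z.add (Z.eqb Z0).

Definition cmono (t : nat * Z * Z) (f : coef) : coef :=
  let: (i, j, x) := t in
  [seq let: (k, l, y) := u in (Nat.add i k, Z.add j l, Z.mul x y) | u <- f].

Fixpoint cmul (f g : coef) : coef :=
  match f with
  | [::] => [::]
  | [:: t] => cmono t g
  | t :: f' => cadd (cmono t g) (cmul f' g)
  end.

Definition c1 : coef := [:: (0, Z0, Zpos 1)].
Definition copp : coef -> coef := cmono (0, Z0, Zneg 1).

Definition word := seq nat.
Definition vec := seq (word * coef).

(** Shortlex order in one pass: [c] keeps the first difference between letters and decides only when
    both words end together. The order is compatible with concatenation on both sides, so [vwrap]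
    keeps lists sorted. *)
Fixpoint word_cmp_acc (c : comparison) (u v : word) : comparison :=
  match u, v with
  | [::], [::] => c
  | [::], _ => Lt
  | _, [::] => Gt
  | x :: u', y :: v' =>
      word_cmp_acc (match c with Eq => Nat.compare x y | _ => c end) u' v'
  end.
Definition word_cmp := word_cmp_acc Eq.

Definition is_nil T (s : seq T) := if s is [::] then true else false.

Definition vadd : vec -> vec -> vec := merge word_cmp cadd (@is_nil _).
Definition vscale (f : coef) (v : vec) : vec :=
  [seq (t.1, cmul f t.2) | t <- v].
Definition vwrap (u z : word) (v : vec) : vec :=
  [seq (u ++ t.1 ++ z, t.2) | t <- v].

Inductive trie (D : Type) : Type := Leaf | Node of option D & seq (trie D).
Arguments Leaf {D}.

Definition root D (t : trie D) := if t is Node o _ then o else None.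
Definition children D (t : trie D) := if t is Node _ cs then cs else [::].
Definition child D (t : trie D) (x : nat) := nth Leaf (children t) x.

Fixpoint lookup D (t : trie D) (w : word) : option D :=
  match w with
  | [::] => root t
  | x :: w' => lookup (child t x) w'
  end.

Fixpoint insert D (w : word) (d : D) (t : trie D) : trie D :=
  match w with
  | [::] => Node (Some d) (children t)
  | x :: w' => Node (root t) (set_nth Leaf (children t) x
                               (insert w' d (child t x)))
  end.

Fixpoint match_prefix D (t : trie D) (w : word) : option (D * word) :=
  match root t with
  | Some d => Some (d, w)
  | None => match w with
    | [::] => None
    | x :: w' => if t is Leaf then None else match_prefix (child t x) w'
    end
  end.

Fixpoint find_factor D (t : trie D) (w : word) : option (word * D * word) :=
  match match_prefix t w with
  | Some (d, z) => Some ([::], d, z)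
  | None => match w with
    | [::] => None
    | x :: w' => match find_factor t w' with
      | Some (u, d, z) => Some (x :: u, d, z)
      | None => None
      end
    end
  end.

(** The leading term is rewritten until it is normal, then emitted. If the fuel runs out, the rest
    is returned unchanged, so the value is preserved in every case. *)
Fixpoint reduce (fuel : nat) (t : trie vec) (v : vec) : vec :=
  match fuel, v with
  | S fuel', (w, c) :: v' => match find_factor t w with
    | None => (w, c) :: reduce fuel' t v'
    | Some (u, d, z) => reduce fuel' t (vadd (vscale c (vwrap u z d)) v')
    end
  | _, _ => v
  end.

(** [Overlap i z u j v] is meant for a critical pair: the leading word of relation i followed by z
    equals the leading word of relation j between u and v, and the two leading terms cancel in the
    difference. With z and v empty, the leading word of j is a suffix of that of i. *)
Inductive step :=
| Given of vec
| Overlap of nat & word & word & nat & word.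

Definition step_vec (rels : seq vec) (s : step) : vec :=
  match s with
  | Given v => v
  | Overlap i z u j v =>
      vadd (vwrap [::] z (nth [::] rels i))
           (vscale (copp c1) (vwrap u v (nth [::] rels j)))
  end.

(** Z[p, q, 1/q] has no units other than plus or minus the powers of q. *)
Definition cunitV (f : coef) : option coef :=
  if f is [:: (0, k, x)] then
    if Z.eqb (Z.mul x x) (Zpos 1) then Some [:: (0, Z.opp k, x)] else None
  else None.

Definition solve (v : vec) : option (word * vec) :=
  if v is (w, c) :: v' then
    if cunitV c is Some c' then Some (w, vscale (copp c') v') else None
  else None.

(** A step without an invertible leading coefficient ends the loop with the rules found so far.
    [rels] stores the relations, made monic, in their order of creation, because overlaps refer to
    them by number. *)
Fixpoint complete (fuel : nat) (ss : seq step) (t : trie vec)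
    (rels : seq vec) : trie vec :=
  match ss with
  | [::] => t
  | s :: ss' => match solve (reduce fuel t (step_vec rels s)) with
    | Some (w, d) => complete fuel ss' (insert w d t) 
                        (rcons rels ((w, c1) :: vscale (copp c1) d))
    | None => t
    end
  end.

(* The letters 2i and 2i+1 stand for t_(i+1) and its inverse, where
   t_i = a^-1 s_i, and a triple (i, j, x) in a coefficient for the monomial
   x p^i q^j, where p = (b + c) / a and q = b c / a^2. *)

Definition cN1 : coef := [:: (0, Z0, Zneg 1)].

Definition cancel_rel : vec := [:: ([:: 0; 1], c1); ([::], cN1)].
Definition cancel_rel' : vec := [:: ([:: 1; 0], c1); ([::], cN1)].

Definition cubic_rel : vec :=
  [:: ([:: 0; 0], c1); ([:: 1], [:: (0, Zpos 1, Zneg 1)]);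
      ([:: 0], [:: (1, Z0, Zneg 1); (0, Z0, Zneg 1)]);
      ([::], [:: (0, Zpos 1, Zpos 1); (1, Z0, Zpos 1)])].

Definition commute_rel : vec := [:: ([:: 4; 0], c1); ([:: 0; 4], cN1)].

Definition artin_rel : vec := [:: ([:: 2; 0; 2], c1); ([:: 0; 2; 0], cN1)].

Definition quartic_rel : vec :=
  [:: ([:: 1; 3; 0], cN1); ([:: 1; 2; 0], c1); ([:: 0; 3; 1], c1);
      ([:: 0; 2; 1], cN1); ([:: 3; 1], cN1); ([:: 3; 0], c1);
      ([:: 2; 1], c1); ([:: 2; 0], cN1); ([:: 1; 3], c1); ([:: 1; 2], cN1);
      ([:: 0; 3], cN1); ([:: 0; 2], c1)].

Definition vshift (v : vec) : vec := [seq (map (addn 2) t.1, t.2) | t <- v].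

Definition givens : seq vec :=
  let r1 := [:: cancel_rel; cancel_rel'; cubic_rel] in
  let r2 := [:: artin_rel; quartic_rel] in
  r1 ++ map vshift r1 ++ map vshift (map vshift r1)
  ++ commute_rel :: r2 ++ map vshift r2.

(** A selection of critical pairs, each of which must produce a new rule for [complete] to go on.
    The relations they produce are numbered from 14 on, after the fourteen [givens]. The list is
    untrusted: [rules_check] judges the outcome. *)
Definition overlaps : seq step := [::
  Overlap 2 [::1] [::0] 0 [::]; Overlap 5 [::3] [::2] 3 [::];
  Overlap 8 [::5] [::4] 6 [::]; Overlap 9 [::1] [::4] 0 [::];
  Overlap 9 [::0] [::4] 2 [::]; Overlap 8 [::0] [::4] 9 [::];
  Overlap 8 [::1] [::4] 18 [::]; Overlap 10 [::3] [::2;0] 3 [::];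
  Overlap 10 [::2] [::2;0] 5 [::]; Overlap 5 [::0;2] [::2] 10 [::];
  Overlap 11 [::1] [::1;3] 0 [::]; Overlap 12 [::5] [::4;2] 6 [::];
  Overlap 12 [::4] [::4;2] 8 [::]; Overlap 8 [::2;4] [::4] 12 [::];
  Overlap 12 [::0] [::4;2] 9 [::]; Overlap 13 [::3] [::3;5] 3 [::];
  Overlap 18 [::3;0] [::4] 11 [::]; Overlap 12 [::1] [::4;2] 18 [::];
  Overlap 20 [::3;0] [::5] 11 [::]; Overlap 4 [::0;3] [::3] 22 [::];
  Overlap 5 [::0;3] [::2] 22 [::]; Overlap 23 [::3] [::3;0] 3 [::];
  Overlap 23 [::2] [::3;0] 5 [::]; Overlap 11 [::2] [::1] 23 [::];
  Overlap 18 [::3;1] [::4] 24 [::]; Overlap 20 [::3;1] [::5] 24 [::];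
  Overlap 7 [::2;5] [::5] 26 [::]; Overlap 8 [::2;5] [::4] 26 [::];
  Overlap 26 [::0] [::4;2] 19 [::]; Overlap 26 [::1] [::4;2] 20 [::];
  Overlap 27 [::5] [::5;2] 6 [::]; Overlap 27 [::4] [::5;2] 8 [::];
  Overlap 27 [::0] [::5;2] 9 [::]; Overlap 13 [::4] [::3] 27 [::];
  Overlap 27 [::1] [::5;2] 18 [::]; Overlap 13 [::0;2] [::3;5] 10 [::];
  Overlap 22 [::5;2] [::2;0] 13 [::]; Overlap 13 [::0;3] [::3;5] 22 [::];
  Overlap 22 [::0;2] [::2;0] 23 [::]; Overlap 26 [::2;4] [::4;2] 27 [::];
  Overlap 22 [::5;3] [::2;0] 29 [::]; Overlap 29 [::0;2] [::3;5] 23 [::];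
  Overlap 30 [::2] [::1;4] 23 [::]; Overlap 32 [::2] [::1;5] 23 [::];
  Overlap 33 [::1] [::3;1;2] 0 [::]; Overlap 37 [::] [::0] 58 [::];
  Overlap 58 [::3] [::3;1] 3 [::]; Overlap 58 [::2] [::3;1] 5 [::];
  Overlap 15 [::1;2] [::3] 58 [::]; Overlap 59 [::2] [::3;0] 4 [::];
  Overlap 9 [::2;1;2] [::4] 36 [::]; Overlap 19 [::2;1;2] [::5] 36 [::];
  Overlap 40 [::3] [::5;3;4] 3 [::]; Overlap 47 [::] [::2] 66 [::];
  Overlap 66 [::5] [::5;3] 6 [::]; Overlap 66 [::4] [::5;3] 8 [::];
  Overlap 66 [::0] [::5;3] 9 [::]; Overlap 16 [::3;4] [::5] 66 [::];
  Overlap 66 [::1] [::5;3] 18 [::]; Overlap 67 [::4] [::5;2] 7 [::];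
  Overlap 67 [::0] [::5;2] 19 [::]; Overlap 67 [::1] [::5;2] 20 [::];
  Overlap 69 [::0] [::5;3] 19 [::]; Overlap 69 [::1] [::5;3] 20 [::];
  Overlap 73 [::0] [::4;3] 19 [::]; Overlap 73 [::1] [::4;3] 20 [::];
  Overlap 45 [::0] [::2;4;3] 9 [::]; Overlap 45 [::1] [::2;4;3] 18 [::];
  Overlap 29 [::1;2] [::3;5] 58 [::]; Overlap 38 [::2] [::1;4] 58 [::];
  Overlap 39 [::2] [::1;5] 58 [::]; Overlap 59 [::5;2] [::3;0] 13 [::];
  Overlap 29 [::0;3] [::3;5] 59 [::]; Overlap 59 [::5;3] [::3;0] 29 [::];
  Overlap 61 [::5;2] [::3;1] 13 [::]; Overlap 61 [::5;3] [::3;1] 29 [::];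
  Overlap 29 [::0;4] [::3] 70 [::]; Overlap 32 [::4] [::1] 70 [::];
  Overlap 71 [::1] [::3;4;3] 18 [::]; Overlap 39 [::4] [::1] 72 [::];
  Overlap 31 [::2;4] [::4;2;1] 12 [::]; Overlap 31 [::2;5] [::4;2;1] 26 [::];
  Overlap 24 [::5;3;0] [::1;3] 32 [::]; Overlap 41 [::0;2] [::4;3;4] 10 [::];
  Overlap 41 [::0;3] [::4;3;4] 22 [::]; Overlap 43 [::2;4] [::4;2;1] 27 [::];
  Overlap 10 [::4;3;4] [::2;0] 45 [::]; Overlap 23 [::4;3;4] [::3;0] 45 [::];
  Overlap 48 [::2;4] [::5;2;1] 12 [::]; Overlap 11 [::5;2;0] [::1] 49 [::];
  Overlap 20 [::2;0;5;2] [::5] 50 [::]; Overlap 51 [::4] [::3;1] 46 [::];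
  Overlap 53 [::0;2] [::4;3;4] 23 [::]; Overlap 20 [::2;0;5;3] [::5] 54 [::];
  Overlap 58 [::4;3;4] [::3;1] 45 [::]; Overlap 53 [::1;2] [::4;3;4] 58 [::];
  Overlap 53 [::0;3] [::4;3;4] 59 [::]; Overlap 43 [::3;4] [::4;2;1] 66 [::];
  Overlap 54 [::4] [::1;2;0] 66 [::]; Overlap 43 [::2;5] [::4;2;1] 67 [::];
  Overlap 59 [::4;3;4] [::3;0] 71 [::]; Overlap 70 [::3;5] [::5;3;0] 73 [::];
  Overlap 49 [::5] [::3;0] 74 [::]; Overlap 51 [::5] [::3;1] 74 [::];
  Overlap 74 [::3;4] [::5;2;0] 66 [::]; Overlap 75 [::2;4] [::5;2;1] 27 [::];
  Overlap 55 [::5] [::3;0] 75 [::]; Overlap 75 [::3;4] [::5;2;1] 66 [::];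
  Overlap 75 [::2;5] [::5;2;1] 67 [::];
  Overlap 39 [::5;3;0] [::1;5;3] 32 [::];
  Overlap 31 [::3;4;2] [::4;2;1] 41 [::];
  Overlap 46 [::3;4;2] [::5;2;0] 41 [::];
  Overlap 50 [::0;4] [::1;2;0] 46 [::]; Overlap 50 [::1;4] [::1;2;0] 48 [::];
  Overlap 31 [::3;4;3] [::4;2;1] 53 [::];
  Overlap 46 [::3;4;3] [::5;2;0] 53 [::];
  Overlap 54 [::0;4] [::1;2;0] 70 [::]; Overlap 54 [::1;4] [::1;2;0] 72 [::];
  Overlap 81 [::3;5] [::2;4;3;1] 73 [::]].

Definition steps : seq step := map Given givens ++ overlaps.

(** * Tables of the regular representation and the checks on them *)

Definition letters : seq nat := iota 0 6.

(** Every prefix of a normal word is normal, so the words of one length are found among the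
    extensions by a letter of those of the previous length. *)
Fixpoint normal_words D (t : trie D) (n : nat) (ws : seq word) : seq word :=
  if n is S n' then
    ws ++ normal_words t n'
      [seq w <- [seq rcons w x | w <- ws, x <- letters] |
        if find_factor t w is None then true else false]
  else [::].

Definition tabulate D (f : word -> D) (ws : seq word) : trie D :=
  foldr (fun w => insert w (f w)) Leaf ws.

Definition regular_table (n : nat) (t : trie vec) : seq word -> trie (seq vec) :=
  tabulate (fun w => [seq reduce n t [:: (rcons w x, c1)] | x <- letters]).

(* Outside of the table every letter acts trivially, so that the relations hold
   there as well. *)
Definition table_row (T : trie (seq vec)) (w : word) (x : nat) : vec :=
  if lookup T w is Some r then nth [::] r x else [:: (w, c1)].

Fixpoint add_pairs (l : seq vec) : seq vec :=
  if l is u :: v :: l' then vadd u v :: add_pairs l' else l.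

(** Balanced summation: each round halves the number of summands, so the 9 rounds in [act] suffice
    for vectors of up to 512 terms, more than the 264 normal words. *)
Fixpoint vsum (n : nat) (l : seq vec) : vec :=
  if n is S n' then
    if l is [:: v] then v else vsum n' (add_pairs l)
  else foldr vadd [::] l.

Definition act (T : trie (seq vec)) (x : nat) (v : vec) : vec :=
  vsum 9 [seq vscale t.2 (table_row T t.1 x) | t <- v].

Definition vsub (u v : vec) : vec := vadd u (vscale (copp c1) v).

Definition cubic_p1 : coef := [:: (1, Z0, Zpos 1); (0, Z0, Zpos 1)].
Definition cubic_pq : coef := [:: (0, Zpos 1, Zpos 1); (1, Z0, Zpos 1)].
Definition cubic_q : coef := [:: (0, Zpos 1, Zpos 1)].

(* The last relation, (A - 1)(b - B)(a - 1) = (a - 1)(b - B)(A - 1), is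
   [quartic_rel] in factored form. *)
Definition regular_relations (T : trie (seq vec)) (w : word) : seq vec :=
  let A := act T in let e := [:: (w, c1)] in
  let a := A 0 e in let a' := A 1 e in let b := A 2 e in let b' := A 3 e in
  let c := A 4 e in let c' := A 5 e in
  let D v := vsub (A 2 v) (A 3 v) in
  [:: vsub (A 1 a) e; vsub (A 0 a') e; vsub (A 3 b) e; vsub (A 2 b') e;
      vsub (A 5 c) e; vsub (A 4 c') e; vsub (A 4 a) (A 0 c);
      vsub (A 0 (A 2 a)) (A 2 (A 0 b)); vsub (A 2 (A 4 b)) (A 4 (A 2 c));
      vsub (vsub (A 0 a) (vscale cubic_p1 a))
           (vsub (vscale cubic_q a') (vscale cubic_pq e));
      let u := D (vsub a' e) in let v := D (vsub a e) in
      vsub (vsub (A 0 u) u) (vsub (A 1 v) v)].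

(** The first test makes the tables a representation. The second, that a normal word acting on the
    empty word gives itself, makes the orbit of the empty word separate the normal words. *)
Definition regular_check (T : trie (seq vec)) (ws : seq word) : bool :=
  all (fun w => all (@is_nil _) (regular_relations T w)) ws &&
  all (fun w => is_nil (vsub (foldl (fun v x => act T x v) [:: ([::], c1)] w)
                             [:: (w, c1)])) ws.

Definition known D (T : trie D) (w : word) : bool :=
  if lookup T w is Some _ then true else false.

(** This also excludes that the length bound in [normal_words] has cut off a normal word: a shortest
    missing one would extend a word of [ws] by a letter, be its own normal form, and be unknown to
    the table. *)
Definition closed_table (T : trie (seq vec)) (ws : seq word) : bool :=
  all (fun w => all (fun x => all (fun t => known T t.1) (table_row T w x))
                    letters) ws.

Fixpoint saturate (n : nat) (t : trie vec) (K : trie unit) (ds : seq word) :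
    trie unit :=
  if ds is d :: ds' then
    if [seq u <- reduce n t [:: (d, c1)] | ~~ known K u.1] is [:: (w, c)] then
      if cunitV c is Some _ then saturate n t (insert w tt K) ds' else K
    else K
  else K.

Definition qwords : seq word :=
  [:: [::]; [:: 0]; [:: 1]; [:: 2]; [:: 3]; [:: 0; 2]; [:: 0; 3]; [:: 1; 2];
      [:: 1; 3]; [:: 2; 0]; [:: 2; 1]; [:: 3; 0]; [:: 3; 1]; [:: 0; 2; 0];
      [:: 0; 2; 1]; [:: 0; 3; 0]; [:: 0; 3; 1]; [:: 1; 2; 0]; [:: 1; 2; 1];
      [:: 2; 1; 2]].

Definition int_letter (i : int) : nat :=
  match i with Posz k => (k.-1).*2 | Negz k => k.*2.+1 end.

Definition nat_words (s : seq (seq int)) : seq word := map (map int_letter) s.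
Definition wprods (X Y : seq word) : seq word := [seq x ++ y | x <- X, y <- Y].

Definition family_tail : seq word :=
  wprods (nat_words famE') (nat_words [:: [:: -3; -2]; [:: -3; -2; 1]]%Z)
  ++ wprods (nat_words famE0) (nat_words [:: [:: -3; 2; -1]]%Z)
  ++ wprods (nat_words famE) (nat_words [:: [:: 3; -2; -1]; [:: 3; 2; -1; 2]]%Z)
  ++ nat_words [:: [:: -3; -2; -1]; [:: -3; 2; -1; 2]]%Z ++ nat_words new_words.

Definition family_words (X : seq word) : seq word :=
  X ++ wprods X (nat_words famF2) ++ family_tail.

(* The normal form of each of these members of the family involves exactly one
   normal word which is neither in the family nor obtained before. *)
Definition pivots : seq word :=
  [:: [:: 1; 4; 3; 0]; [:: 3; 5; 2]; [:: 3; 5; 2; 0]; [:: 0; 3; 5; 2];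
      [:: 0; 3; 5; 2; 0]; [:: 1; 3; 5; 2]; [:: 2; 1; 4; 3; 0];
      [:: 3; 0; 5; 2; 0]; [:: 3; 1; 4; 3; 0]; [:: 0; 2; 1; 4; 3; 0];
      [:: 0; 3; 0; 5; 2; 0]; [:: 0; 3; 1; 4; 3; 0]; [:: 1; 2; 0; 5; 2];
      [:: 1; 2; 0; 5; 2; 0]; [:: 1; 2; 1; 5; 2]; [:: 1; 2; 1; 4; 3; 0];
      [:: 2; 1; 2; 5; 2]; [:: 1; 5; 3; 0]; [:: 3; 5; 2; 1]; [:: 4; 3; 4; 0];
      [:: 4; 3; 4; 1]; [:: 4; 3; 4; 0; 2]; [:: 4; 3; 4; 0; 3];
      [:: 4; 3; 4; 1; 2]; [:: 4; 3; 4; 1; 3]; [:: 2; 0; 4; 3; 4; 0];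
      [:: 0; 4; 3; 4; 0; 2]; [:: 0; 4; 3; 4; 0; 3]; [:: 0; 4; 3; 4; 1];
      [:: 0; 4; 3; 4; 0]; [:: 2; 0; 4; 3; 4; 0; 2]; [:: 2; 0; 4; 3; 4; 0; 3];
      [:: 4; 3; 4; 0; 3; 0]; [:: 1; 3; 5; 2; 0]; [:: 2; 1; 5; 3; 0];
      [:: 3; 1; 5; 3; 0]; [:: 3; 1; 5; 2; 0]; [:: 0; 3; 1; 5; 2; 0];
      [:: 3; 0; 3; 5; 2; 0]; [:: 3; 1; 3; 5; 2; 0]; [:: 0; 3; 0; 5; 3; 0];
      [:: 1; 3; 4; 2; 1; 2]; [:: 3; 0; 4; 3; 4; 0]; [:: 5; 3; 0; 3; 5];
      [:: 2; 1; 2; 4; 2; 1; 2]; [:: 2; 1; 2; 4; 3; 1]].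

(** Any words in s_1 and s_2 may stand here for the arbitrary basis of Q_3, since the family spans
    the image of Q_3 and its products with [famF2]. The two words beyond [qwords] occur in pivots,
    multiplied by [[:: 5; 2; 0]]. *)
Definition saturation_check (n : nat) (t : trie vec) (ws : seq word) : bool :=
  let K := tabulate (fun _ => tt)
             (family_words (qwords ++ [:: [:: 3; 0; 3]; [:: 3; 1; 3]])) in
  all (known K) pivots && all (known (saturate n t K pivots)) ws.

Definition rules_check (n : nat) (t : trie vec) : bool :=
  let ws := normal_words t 8 [:: [::]] in
  let T := regular_table n t ws in
  [&& size ws == 264, uniq ws, closed_table T ws, regular_check T ws &
      saturation_check n t ws].

Local Open Scope ring_scope.

(** * Semantics of the computations *)

Section MergeTheory.
Variables (K V : Type) (cmp : K -> K -> comparison) (add : V -> V -> V).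
Variables (is0 : V -> bool) (M : zmodType) (F : K -> V -> M).
Hypothesis cmpE : forall k l, cmp k l = Eq -> k = l.
Hypothesis FD : forall k x y, F k (add x y) = F k x + F k y.
Hypothesis F0 : forall k x, is0 x -> F k x = 0.

Lemma sum_merge s t :
  \sum_(u <- merge cmp add is0 s t) F u.1 u.2 =
  \sum_(u <- s) F u.1 u.2 + \sum_(u <- t) F u.1 u.2.
Proof.
elim: s t => [|[k x] s IHs] t; first by rewrite big_nil add0r.
elim: t => [|[l y] t IHt]; first by rewrite big_nil addr0.
rewrite [merge _ _ _ _ _]/=; case Ekl: (cmp k l).
- have zE : F k (add x y) = F k x + F l y by rewrite FD (cmpE Ekl).
  rewrite [in RHS]big_cons [in X in _ + X]big_cons /= addrACA -zE.
  by case: ifP => [/F0 ->|_]; rewrite ?add0r ?big_cons IHs.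
- by rewrite big_cons IHt [in X in _ = _ + X]big_cons addrCA.
- by rewrite big_cons IHs [in X in _ = X + _]big_cons addrA.
Qed.
End MergeTheory.

Section CoefTheory.
Variables (R : comNzRingType) (p : R) (q : Z -> R).
Hypothesis q0 : q Z0 = 1.
Hypothesis qD : forall i j, q (Z.add i j) = q i * q j.

(** Taking [q] as a homomorphism from Z gives negative exponents a meaning without an inverse
    operation on R. *)
Definition mono_eval (m : nat * Z) (x : Z) : R :=
  (int_of_Z x)%:~R * (p ^+ m.1 * q m.2).

Definition ceval (f : coef) : R := \sum_(t <- f) mono_eval t.1 t.2.

Lemma mono_cmpE m n : mono_cmp m n = Eq -> m = n.
Proof.
case: m n => [i j] [k l]; rewrite /mono_cmp /=.
case E: Z.compare => // /PeanoNat.Nat.compare_eq ->.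
by rewrite (Z.compare_eq _ _ E).
Qed.

Lemma ceval_add f g : ceval (cadd f g) = ceval f + ceval g.
Proof.
apply: sum_merge => [m n /mono_cmpE //|m x y|m x].
  by rewrite /mono_eval -mulrDl -intrD; congr (_%:~R * _); apply: (rmorphD int_of_Z).
by move=> /Z.eqb_eq <-; rewrite /mono_eval mul0r.
Qed.

Lemma ceval_mono t f : ceval (cmono t f) = mono_eval t.1 t.2 * ceval f.
Proof.
case: t => [[i j] x]; rewrite /ceval /cmono big_map mulr_sumr.
apply: eq_bigr => -[[k l] y] _; rewrite /mono_eval /=.
rewrite (rmorphM int_of_Z) intrM qD -[Nat.add i k]/(i + k)%N exprD.
by rewrite [X in _ * X]mulrACA [LHS]mulrACA.
Qed.

Lemma ceval_mul f g : ceval (cmul f g) = ceval f * ceval g.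
Proof.
elim: f => [|t f IH]; first by rewrite /ceval /= !big_nil mul0r.
rewrite [X in X * _]/ceval big_cons mulrDl -/(ceval f) -IH.
case: f IH => [|u f] IH /=; last by rewrite ceval_add ceval_mono.
by rewrite ceval_mono [ceval [::]]/ceval big_nil addr0.
Qed.

Lemma ceval1 : ceval c1 = 1.
Proof. by rewrite /ceval big_seq1 /mono_eval /= q0 !mul1r. Qed.

Lemma ceval_opp f : ceval (copp f) = - ceval f.
Proof. by rewrite ceval_mono /mono_eval /= expr0 q0 !mulr1 mulN1r. Qed.

Lemma cunitVP f g : cunitV f = Some g -> ceval g * ceval f = 1.
Proof.
case: f => [|[[[|//] k] x] [|//]] //=; case: Z.eqb_spec => // xx [<-].
rewrite /ceval !big_seq1 /mono_eval /= !expr0 !mul1r mulrACA -intrM -qD.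
by rewrite Z.add_opp_diag_l q0 mulr1 -(rmorphM int_of_Z) /= -[_ * _]/(Z.mul x x) xx.
Qed.

Lemma ceval_cubic_p1 : ceval cubic_p1 = 1 + p.
Proof.
rewrite /ceval !big_cons big_nil /mono_eval /= q0 addr0 addrC.
by rewrite -[Pos.to_nat 1]/1%N !mulr1 !mul1r.
Qed.

Lemma ceval_cubic_q : ceval cubic_q = q (Zpos 1).
Proof. by rewrite /ceval big_seq1 /mono_eval /= mul1r mul1r. Qed.

Lemma ceval_cubic_pq : ceval cubic_pq = p + q (Zpos 1).
Proof.
rewrite /ceval !big_cons big_nil /mono_eval /= q0 addr0 addrC.
by rewrite -[Pos.to_nat 1]/1%N !mulr1 !mul1r.
Qed.

Lemma word_cmp_accE c u v : word_cmp_acc c u v = Eq -> c = Eq /\ u = v.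
Proof.
elim: u v c => [|x u IH] [|y v] c //= /IH[]; case: c => //.
by move=> /PeanoNat.Nat.compare_eq -> ->.
Qed.

Section Vectors.
Variables (M : lmodType R) (e : word -> M).

Definition veval (v : vec) : M := \sum_(t <- v) ceval t.2 *: e t.1.

Lemma veval_nil : veval [::] = 0. Proof. exact: big_nil. Qed.

Lemma veval_cons t v : veval (t :: v) = ceval t.2 *: e t.1 + veval v.
Proof. exact: big_cons. Qed.

Lemma veval_add u v : veval (vadd u v) = veval u + veval v.
Proof.
apply: (sum_merge (F := fun w c => ceval c *: e w))
  => [w w' /word_cmp_accE[]//|w f g|w f].
  by rewrite ceval_add scalerDl.
by case: f => // _; rewrite /ceval big_nil scale0r.
Qed.

Lemma veval_scale f v : veval (vscale f v) = ceval f *: veval v.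
Proof.
rewrite /veval big_map scaler_sumr; apply: eq_bigr => t _.
by rewrite ceval_mul scalerA.
Qed.

Lemma veval1 w : veval [:: (w, c1)] = e w.
Proof. by rewrite veval_cons veval_nil ceval1 scale1r addr0. Qed.

Lemma solveP v w d : solve v = Some (w, d) -> veval v = 0 -> e w = veval d.
Proof.
case: v => [//|[u c] v] /=; case E: cunitV => [c'|//] [<- <-].
rewrite veval_cons /= => /(congr1 ( *:%R (ceval c'))) /eqP.
rewrite scaler0 scalerDr scalerA (cunitVP E) scale1r addr_eq0 => /eqP ->.
by rewrite veval_scale ceval_opp scaleNr.
Qed.
End Vectors.
End CoefTheory.

Definition lau_p : laurent := lau_aV * (lau_b + lau_c).
(** The power z of b c / a^2, written directly as a monomial. *)
Definition lau_q (z : Z) : laurent :=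
  let j := int_of_Z z in lmon (- j *+ 2) j j.

Lemma lau_q0 : lau_q Z0 = 1. Proof. by []. Qed.

Lemma lau_qD i j : lau_q (Z.add i j) = lau_q i * lau_q j.
Proof.
rewrite /lau_q lmonM [int_of_Z _](rmorphD int_of_Z).
by rewrite -mulrnDl -opprD.
Qed.

Lemma lau_q1 : lau_q (Zpos 1) = lau_aV ^+ 2 * (lau_b * lau_c).
Proof. by rewrite expr2 !lmonM. Qed.

(** * Modules over Q_n from braid group actions *)

Lemma artin_ord n i (lin : (i < n.-1)%N) :
  artin n i.+1 = (\pi_(braid_group n) [:: (Ordinal lin, true)])%qT.
Proof. by rewrite /artin /= insubT. Qed.

Section RightAction.
Variables (n : nat) (M : lmodType laurent).
Variable op : 'I_n.-1 * bool -> M -> M.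
Hypothesis opD : forall l, {morph op l : x y / x + y}.
Hypothesis opZ : forall l r, {morph op l : x / r *: x}.

(** Words act from the right, first letter first, as the tables record right multiplication by
    letters. Hence the reversed order in [braid_actM] and [ring_actM]. *)
Definition word_act (w : braid_word n) (m : M) : M := foldl (fun m l => op l m) m w.

Hypothesis opK : forall i e m, op (i, ~~ e) (op (i, e) m) = m.
Hypothesis op_artin : forall (i j : 'I_n.-1) m, j = i.+1 :> nat ->
  word_act [:: (i, true); (j, true); (i, true)] m =
  word_act [:: (j, true); (i, true); (j, true)] m.
Hypothesis op_commute : forall (i j : 'I_n.-1) m, (i.+1 < j)%N ->
  op (j, true) (op (i, true) m) = op (i, true) (op (j, true) m).

Lemma word_act_eqv u v : braid_eqv u v -> word_act u =1 word_act v.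
Proof.
elim=> [//|{}u {}v _ uv m|{}u {}v w _ uv _ vw m|{}u u' {}v v' _ uu' _ vv' m|||].
- by rewrite uv.
- by rewrite uv.
- by rewrite /word_act !foldl_cat -!/(word_act _ _) uu' vv'.
- by move=> i e m; apply: opK.
- by move=> i j ij m; apply: op_artin.
- by move=> i j ij m; apply: op_commute.
Qed.

Definition braid_act (g : braid_group n) (m : M) : M := word_act (repr g) m.

Lemma braid_act_pi w m : braid_act (\pi_(braid_group n) w)%qT m = word_act w m.
Proof. exact/word_act_eqv/braid_repr_pi. Qed.

Lemma braid_act_artin i (lin : (i < n.-1)%N) m :
  braid_act (artin n i.+1) m = op (Ordinal lin, true) m.
Proof. by rewrite artin_ord braid_act_pi. Qed.

Lemma braid_act_artinV i (lin : (i < n.-1)%N) m :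
  braid_act (artin n i.+1)^-1%g m = op (Ordinal lin, false) m.
Proof. by rewrite artin_ord [(_^-1)%g]braid_inv_pi braid_act_pi. Qed.

Lemma braid_actM g h m : braid_act (g * h)%g m = braid_act h (braid_act g m).
Proof.
rewrite -[g]reprK -[h]reprK [(_ * _)%g]braid_mul_pi !braid_act_pi.
exact: foldl_cat.
Qed.

Lemma braid_act1 m : braid_act 1%g m = m.
Proof. exact: (braid_act_pi [::]). Qed.

Lemma braid_act_word w m : braid_act (artin_word n w) m =
  foldl (fun m i => braid_act (artin_letter n i) m) m w.
Proof.
rewrite /artin_word; elim: w m => [|i w IH] m; first by rewrite big_nil braid_act1.
by rewrite big_cons braid_actM IH.
Qed.

Lemma braid_actD g : {morph braid_act g : x y / x + y}.
Proof.
rewrite /braid_act /word_act; elim: (repr g) => //= l w IH x y.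
by rewrite opD IH.
Qed.

Lemma braid_actZ g r : {morph braid_act g : x / r *: x}.
Proof.
rewrite /braid_act /word_act; elim: (repr g) => //= l w IH x.
by rewrite opZ IH.
Qed.

Lemma braid_act0 g : braid_act g 0 = 0.
Proof. by rewrite -(scale0r 0) braid_actZ !scale0r. Qed.

Definition ring_act (x : RB n) (m : M) : M :=
  \sum_(g <- msupp x) x@_g *: braid_act g m.

Lemma ring_actw (d : {fset braid_group n}) (x : RB n) m : (msupp x `<=` d)%fset ->
  ring_act x m = \sum_(g <- d) x@_g *: braid_act g m.
Proof.
move=> led; rewrite /ring_act (big_fset_incl _ led) //=.
by move=> g _ /mcoeff_outdom ->; rewrite scale0r.
Qed.

Lemma ring_actDl (x y : RB n) m : ring_act (x + y) m = ring_act x m + ring_act y m.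
Proof.
rewrite (ring_actw _ (msuppD_le x y)) (ring_actw _ (fsubsetUl _ (msupp y))).
rewrite (ring_actw _ (fsubsetUr (msupp x) _)) -big_split /=.
by apply: eq_bigr => g _; rewrite mcoeffD scalerDl.
Qed.

Lemma ring_act0l m : ring_act 0 m = 0.
Proof. by rewrite /ring_act msupp0 big_seq_fset0. Qed.

Lemma ring_actU r g m : ring_act << r *g g >> m = r *: braid_act g m.
Proof. by rewrite (ring_actw _ msuppU_le) big_seq_fset1 mcoeffUU. Qed.

Lemma ring_act_sum (I : Type) (s : seq I) (E : I -> RB n) m :
  ring_act (\sum_(i <- s) E i) m = \sum_(i <- s) ring_act (E i) m.
Proof.
exact: (big_morph (ring_act^~ m) (fun x y => ring_actDl x y m) (ring_act0l m)).
Qed.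

Lemma ring_actDr (x : RB n) : {morph ring_act x : m m' / m + m'}.
Proof.
move=> m m'; rewrite /ring_act -big_split /=; apply: eq_bigr => g _.
by rewrite braid_actD scalerDr.
Qed.

Lemma ring_act0r (x : RB n) : ring_act x 0 = 0.
Proof. by rewrite /ring_act big1 // => g _; rewrite braid_act0 scaler0. Qed.

Lemma ring_actM (x y : RB n) m : ring_act (x * y) m = ring_act y (ring_act x m).
Proof.
rewrite (monalgE x) [X in ring_act X _]gr_mul_suml !ring_act_sum.
rewrite (big_morph _ (ring_actDr y) (ring_act0r y)); apply: eq_bigr => g _.
rewrite (monalgE y) [X in ring_act X _]gr_mul_sumr !ring_act_sum.
apply: eq_bigr => h _; rewrite gr_mulUU !ring_actU braid_actM.
by rewrite braid_actZ scalerA mulrC.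
Qed.

Lemma ring_actZ r (x : RB n) m : ring_act (r *: x) m = r *: ring_act x m.
Proof.
rewrite gr_scaleE ring_actM ring_actU braid_act1.
rewrite /ring_act scaler_sumr; apply: eq_bigr => g _.
by rewrite braid_actZ !scalerA mulrC.
Qed.

Lemma ring_actB (x y : RB n) m : ring_act (x - y) m = ring_act x m - ring_act y m.
Proof. by rewrite -[- y]scaleN1r ring_actDl ring_actZ scaleN1r. Qed.

Lemma ring_act_scalar r m : ring_act r%:A m = r *: m.
Proof.
apply: etrans (ring_actZ r 1 m) _; congr (_ *: _).
by apply: etrans (ring_actU 1 1%g m) _; rewrite scale1r braid_act1.
Qed.

Lemma ring_act_rbw w m : ring_act (rbw n w) m = braid_act (artin_word n w) m.
Proof. by rewrite ring_actU scale1r. Qed.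

Hypothesis relators0 : forall m,
  ring_act (cubic_relator n) m = 0 /\ ring_act (quartic_relator n) m = 0.

(** The relators have to kill every vector: in u x v the factor u moves m before x acts, so m is
    generalised in the induction. *)
Lemma ring_act_ideal x m : gen_ideal (@Q_relators n) x -> ring_act x m = 0.
Proof.
move=> Ix; elim: Ix m => [{}x xR||{}x y _ x0 _ y0|u {}x v _ x0] m.
- by case: (relators0 m); case: xR => ->.
- exact: ring_act0l.
- by rewrite ring_actDl x0 y0 addr0.
- by rewrite !ring_actM x0 ring_act0r.
Qed.

Definition Q_act (x : Q n) (m : M) : M := ring_act (repr x) m.

Lemma Q_act_pi x m : Q_act (\pi_(Q n) x)%qT m = ring_act x m.
Proof.
have /(ring_act_ideal m) := quot_alg_repr (@Q_relators n) x.
by rewrite ring_actB => /subr0_eq.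
Qed.

Lemma Q_actD x y m : Q_act (x + y) m = Q_act x m + Q_act y m.
Proof.
by rewrite -[x]reprK -[y]reprK -quot_piD !Q_act_pi ring_actDl.
Qed.

Lemma Q_actZ r x m : Q_act (r *: x) m = r *: Q_act x m.
Proof.
by rewrite -[x]reprK [_ *: _ in LHS]quot_scale_pi !Q_act_pi ring_actZ.
Qed.

Lemma Q_act_qw w m : Q_act (qw n w) m = braid_act (artin_word n w) m.
Proof. by rewrite Q_act_pi ring_act_rbw. Qed.
End RightAction.

(** * Soundness of rewriting *)

Section TrieTheory.
Variable D : Type.
Implicit Types (t : trie D) (w : word) (d : D).

Lemma lookup_insert w d t w' :
  lookup (insert w d t) w' = if w == w' then Some d else lookup t w'.
Proof.
elim: w t w' => [|x w IH] t [|y w'] //=.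
rewrite /child /= nth_set_nth /= eqseq_cons [x == y]eq_sym.
by case: (y =P x) => [->|_] //=; rewrite IH.
Qed.

Lemma lookup_Leaf w : lookup (@Leaf D) w = None.
Proof. by elim: w => //= x w IH; rewrite /child nth_nil. Qed.

Lemma match_prefixP t w d z : match_prefix t w = Some (d, z) ->
  exists2 u, w = u ++ z & lookup t u = Some d.
Proof.
elim: w t => [|x w IH] t /=; case E: (root t) => [d'|] //.
- by case=> <- <-; exists [::].
- by case=> <- <-; exists [::].
- case: t E => // o cs _ /IH[u -> tu]; by exists (x :: u).
Qed.

Lemma find_factor_cons t x w : find_factor t (x :: w) =
  match match_prefix t (x :: w) with
  | Some (d, z) => Some ([::], d, z)
  | None => if find_factor t w is Some (u, d, z) then Some (x :: u, d, z)
            else None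
  end.
Proof. by []. Qed.

Lemma find_factorP t w u d z : find_factor t w = Some (u, d, z) ->
  exists2 l, w = u ++ l ++ z & lookup t l = Some d.
Proof.
elim: w u d z => [|x w IH] u d z; first rewrite /=.
  by case E: (root t) => [d'|] // [<- <- <-]; exists [::].
rewrite find_factor_cons.
case E: (match_prefix t (x :: w)) => [[d' z']|].
  by case=> <- <- <-; have [l -> tl] := match_prefixP E; exists l.
case F: find_factor => [[[u' d'] z']|] // [<- <- <-].
by have [l -> tl] := IH _ _ _ F; exists l.
Qed.
End TrieTheory.

Section Rewriting.
Variables (R : comNzRingType) (p : R) (q : Z -> R) (A : algType R).
Hypothesis q0 : q Z0 = 1.
Hypothesis qD : forall i j, q (Z.add i j) = q i * q j.
Variable g : nat -> A.

Definition wprod (w : word) : A := \prod_(x <- w) g x.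
Local Notation ev := (veval p q wprod).

Lemma wprod_cat u v : wprod (u ++ v) = wprod u * wprod v.
Proof. exact: big_cat. Qed.

Lemma veval_wrap u z v : ev (vwrap u z v) = wprod u * ev v * wprod z.
Proof.
rewrite /veval big_map mulr_sumr mulr_suml; apply: eq_bigr => t _ /=.
by rewrite !wprod_cat mulrA -scalerAr -scalerAl.
Qed.

Definition sound_trie (t : trie vec) : Prop :=
  forall w d, lookup t w = Some d -> wprod w = ev d.

Lemma sound_Leaf : sound_trie Leaf.
Proof. by move=> w d; rewrite lookup_Leaf. Qed.

Lemma sound_insert t w d :
  sound_trie t -> wprod w = ev d -> sound_trie (insert w d t).
Proof.
by move=> ts wd w' d'; rewrite lookup_insert; case: eqP => [<- [<-]|_ /ts].
Qed.

Lemma veval_reduce n t v : sound_trie t -> ev (reduce n t v) = ev v.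
Proof.
move=> ts; elim: n v => [|n IH] [|[w c] v] //=.
case E: find_factor => [[[u d] z]|]; last by rewrite !veval_cons IH.
have [l -> /ts ld] := find_factorP E.
by rewrite IH veval_add veval_scale // veval_cons veval_wrap -ld !wprod_cat mulrA.
Qed.

Definition sound_step (s : step) : Prop :=
  if s is Given v then ev v = 0 else True.

Lemma step_vec0 rels s : (forall i, ev (nth [::] rels i) = 0) ->
  sound_step s -> ev (step_vec rels s) = 0.
Proof.
case: s => [v //|i z u j v] rels0 _ /=.
rewrite veval_add veval_scale // !veval_wrap !rels0.
by rewrite !(mul0r, mulr0) scaler0 addr0.
Qed.

(** Only the given relations call for a proof. An overlap is a combination of multiples of earlier
    relations and vanishes for all indices and words, an index out of range standing for the zero
    vector. *)
Lemma sound_complete n ss t rels :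
  (forall s, List.In s ss -> sound_step s) -> sound_trie t ->
  (forall i, ev (nth [::] rels i) = 0) -> sound_trie (complete n ss t rels).
Proof.
elim: ss t rels => [//|s ss IH] t rels ssP ts rels0 /=.
case E: solve => [[w d]|//].
have wd : wprod w = ev d.
  apply: (solveP q0 qD E); rewrite veval_reduce //; apply: step_vec0 => //.
  by apply: ssP; left.
apply: IH => [s' ss'||i]; first by apply: ssP; right.
  exact: sound_insert.
rewrite nth_rcons; case: ifP => // _; case: ifP => // _; last exact: veval_nil.
by rewrite veval_cons veval_scale // ceval_opp // ceval1 // scale1r wd scaleN1r subrr.
Qed.
End Rewriting.

(** * The relations in the scaled generators *)

Section Relators.
Variables (R : comNzRingType) (A : algType R).
Variables (a aV b c : R) (q : Z -> R).
Hypothesis aK : a * aV = 1.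
Hypothesis q0 : q Z0 = 1.
Hypothesis qD : forall i j, q (Z.add i j) = q i * q j.
Hypothesis q1 : q (Zpos 1) = aV ^+ 2 * (b * c).
Let p : R := aV * (b + c).

Definition letter_int (x : nat) : int :=
  if odd x then - (x./2.+1)%:Z else (x./2.+1)%:Z.

Definition letter_scale (x : nat) : R := if odd x then a else aV.

Variable W : seq int -> A.
Hypothesis W0 : W [::] = 1.
Hypothesis W_cat : forall u v, W (u ++ v) = W u * W v.

Definition scaled_letter (x : nat) : A := letter_scale x *: W [:: letter_int x].

Local Notation wp := (wprod scaled_letter).
Local Notation ev := (veval p q wp).

Lemma wprod_scaled w :
  wp w = (\prod_(x <- w) letter_scale x) *: W (map letter_int w).
Proof.
elim: w => [|x w IH]; first by rewrite /wprod !big_nil scale1r W0.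
rewrite /wprod !big_cons -/(wp w) IH -cat1s map_cat.
by rewrite W_cat /scaled_letter -scalerAl -scalerAr scalerA.
Qed.

Lemma ceval_N1 : ceval p q cN1 = -1.
Proof. by rewrite -[cN1]/(copp c1) ceval_opp // ceval1. Qed.

Lemma veval_binomial u v : wp u = wp v -> ev [:: (u, c1); (v, cN1)] = 0.
Proof.
move=> uv; rewrite !veval_cons veval_nil ceval1 // ceval_N1 /= uv.
by rewrite scale1r scaleN1r addr0 subrr.
Qed.

Lemma cubic_expand (s : A) (x y z : R) :
  (s - x%:A) * (s - y%:A) * (s - z%:A) =
  s * s * s - (x + y + z) *: (s * s) + (x * y + x * z + y * z) *: s
  - (x * y * z)%:A.
Proof.
have mulB (u : A) r : u * (s - r%:A) = u * s - r *: u by rewrite mulrBr mulr_algr.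
rewrite !mulB !mulrBl !mulr_algl !scalerBr !scalerA -!scalerAl !scalerDl.
rewrite mulrBl -scalerAl mulr_algl [z * x]mulrC [z * y]mulrC.
rewrite [y * x]mulrC [y * z * x]mulrC [x * (y * z)]mulrA.
rewrite !opprB !opprD !addrA.
by rewrite [LHS](ACl (1*2*4*8*3*7*5*6)%AC).
Qed.

(** [cubic_rel] is the cubic relation times a^-2 and times s_1^-1 on the right. As inverses are
    letters, this division turns the cubic into a rule for the square of a generator. *)
Lemma veval_cubic :
  W [:: 1]%Z * W [:: -1]%Z = 1 ->
  (W [:: 1]%Z - a%:A) * (W [:: 1]%Z - b%:A) * (W [:: 1]%Z - c%:A) = 0 ->
  ev cubic_rel = 0.
Proof.
rewrite cubic_expand; set s := W [:: 1]%Z; set S := W [:: -1]%Z => sS.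
move=> /(congr1 (fun x => aV ^+ 2 *: (x * S))); rewrite mul0r scaler0 => <-.
rewrite !(mulrBl, mulrDl) -!scalerAl -!mulrA sS !mulr1 mul1r.
rewrite !(scalerBr, scalerDr) !scalerA.
rewrite !veval_cons veval_nil addr0 !wprod_scaled /=.
rewrite [W [:: _; _]](W_cat [:: 1]%Z [:: 1]%Z) -/s W0.
rewrite /letter_scale !big_cons !big_nil !mulr1 ceval1 // !scalerA.
have aVa x : aV ^+ 2 * (a * x) = aV * x.
  by rewrite expr2 mulrA -(mulrA aV) (mulrC aV a) aK mulr1.
have -> : ceval p q [:: (0%N, Zpos 1, Zneg 1)] * a = - (aV ^+ 2 * (a * (b * c))).
  by rewrite /ceval big_seq1 /mono_eval /= q1; ring.
have -> : ceval p q [:: (1%N, Z0, Zneg 1); (0%N, Z0, Zneg 1)] * aV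
    = - (aV ^+ 2 * (a + b + c)).
  rewrite -[a in RHS]mulr1 !mulrDr aVa /ceval !big_cons big_nil /mono_eval /= q0 /p.
  by rewrite mulr1; ring.
have -> : ceval p q [:: (0%N, Zpos 1, Zpos 1); (1%N, Z0, Zpos 1)] * 1
    = aV ^+ 2 * (a * b + a * c + b * c).
  rewrite !mulrDr !aVa /ceval !big_cons big_nil /mono_eval /= q0 q1 /p.
  by rewrite -[Pos.to_nat 1]/1%N; ring.
rewrite mul1r -[(if odd 0 then a else aV) * aV]/(aV ^+ 2) !scaleNr !addrA.
by rewrite [LHS](ACl (1*3*4*2)%AC).
Qed.
(** After multiplication by a^-1, the power of a left on each term is exactly the one that converts
    its s_i into t_i. *)
Lemma veval_quartic :
  W [:: -1; 2; 1]%Z -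
  (W [:: 1; 2; -1]%Z - aV *: W [:: 1; 2]%Z + a *: W [:: 1; -2]%Z
   + a *: W [:: -1; 2]%Z - a ^+ 3 *: W [:: -1; -2]%Z + aV *: W [:: 2; 1]%Z
   - a *: W [:: 2; -1]%Z - a *: W [:: -2; 1]%Z
   + a ^+ 3 *: W [:: -2; -1]%Z + a ^+ 2 *: W [:: -1; -2; 1]%Z
   - a ^+ 2 *: W [:: 1; -2; -1]%Z) = 0 ->
  ev quartic_rel = 0.
Proof.
move=> /(congr1 ( *:%R aV)); rewrite scaler0 => <-.
rewrite !veval_cons veval_nil addr0 !wprod_scaled /= !big_cons !big_nil.
rewrite ceval1 // ceval_N1 !scale1r !scaleN1r !mulr1.
rewrite !(scalerBr, scalerDr) !scalerA.
rewrite /letter_scale /=.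
have aVa : aV * a = 1 by rewrite mulrC.
rewrite !exprS expr0 !mulr1 !(mulrA aV) !aVa !mul1r !aK !mulr1 (mulrA a aV) aK mul1r.
rewrite !scale1r -!mulrA ?aVa ?mulr1 !opprB !opprD !opprK !addrA.
rewrite -[letter_int 0]/1%Z -[letter_int 1]/(-1)%Z.
rewrite -[letter_int 2]/2%Z -[letter_int 3]/(-2)%Z.
by rewrite [LHS](ACl (2*3*4*12*11*10*9*8*7*6*5*1)%AC).
Qed.

Variables (D E : A).
Hypothesis DE : D * E = 1.
Hypothesis D_letter : forall x, (x < 4)%N ->
  D * W [:: letter_int x] = W [:: letter_int x.+2] * D.

Lemma wprod_shift w : all (fun x => x < 4)%N w ->
  D * wp w = wp (map (addn 2) w) * D.
Proof.
rewrite /wprod; elim: w => [|x w IH /= /andP[x4 w4]].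
  by rewrite !big_nil mulr1 mul1r.
rewrite !big_cons mulrA /scaled_letter.
have -> : letter_scale (2 + x) = letter_scale x by rewrite /letter_scale /= negbK.
by rewrite -scalerAr -[(2 + x)%N]/x.+2 D_letter // -!scalerAl -!mulrA IH.
Qed.

(** The shifted relation is the conjugate of the original by [D], and [D] can be cancelled on the
    right. In Q_4, [D] is s_1 s_2 s_3, and relations between s_1 and s_2 become relations between
    s_2 and s_3. *)
Lemma veval_shift v : all (fun t => all (fun x => x < 4)%N t.1) v ->
  ev v = 0 -> ev (vshift v) = 0.
Proof.
move=> /allP v4 v0; rewrite -[LHS]mulr1 -DE mulrA.
suff -> : ev (vshift v) * D = D * ev v by rewrite v0 mulr0 mul0r.
rewrite /veval big_map mulr_suml mulr_sumr !big_seq; apply: eq_bigr => t tv /=.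
by rewrite -scalerAl -wprod_shift ?v4 // scalerAr.
Qed.
End Relators.

(** * The regular representation *)

Section RegularOps.
Variables (R : comNzRingType) (M : lmodType R) (t : nat -> {linear M -> M}).
Variables k1 kq kpq : R.
Implicit Types F G : {linear M -> M}.

Definition lsub F G : {linear M -> M} := (F \- G : _ -> _).
Definition lcomp F G : {linear M -> M} := (F \o G : _ -> _).
Definition lscale (r : R) F : {linear M -> M} := (r \*: F : _ -> _).
Definition lid : {linear M -> M} := (idfun : _ -> _).
(** The entries of [regular_relations], in the same order, as linear maps, so that their vanishing
    can be tested on basis words. *)
Definition regular_ops : seq {linear M -> M} :=
  let A x F := lcomp (t x) F in
  let a := t 0 in let a' := t 1 in let b := t 2%N in let b' := t 3%N in
  let c := t 4%N in let c' := t 5%N in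
  let D F := lsub (A 2%N F) (A 3%N F) in
  let u := D (lsub a' lid) in let v := D (lsub a lid) in
  [:: lsub (A 1 a) lid; lsub (A 0 a') lid; lsub (A 3%N b) lid;
      lsub (A 2%N b') lid;
      lsub (A 5%N c) lid; lsub (A 4%N c') lid; lsub (A 4%N a) (A 0 c);
      lsub (A 0 (A 2%N a)) (A 2%N (A 0 b)); lsub (A 2%N (A 4%N b)) (A 4%N (A 2%N c));
      lsub (lsub (A 0 a) (lscale k1 a))
           (lsub (lscale kq a') (lscale kpq lid));
      lsub (lsub (A 0 u) u) (lsub (A 1 v) v)].

(** This settles the words outside the table. Where all letters act as 1, the braid relations are
    trivial, the factors a - 1 and A - 1 kill the last relation, and the cubic holds because 1 is
    one of its roots, which is what the equation on the constants says. *)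
Lemma regular_ops_fix e : (forall x, t x e = e) -> k1 + kq = 1 + kpq ->
  [seq F e | F : {linear M -> M} <- regular_ops] = nseq 11 0.
Proof.
move=> te kE; rewrite /= !(te, subrr, linear0).
have -> : e - k1 *: e - (kq *: e - kpq *: e) = (1 + kpq - (k1 + kq)) *: e.
  rewrite scalerBl !scalerDl scale1r !opprD opprK !addrA.
  by rewrite [LHS](ACl (1*4*2*3)%AC).
by rewrite kE subrr scale0r.
Qed.

Variables (ev : vec -> M) (T : trie (seq vec)).
Hypothesis ev_act : forall x v, ev (act T x v) = t x (ev v).
Hypothesis ev_sub : forall u v, ev (vsub u v) = ev u - ev v.
Hypotheses (ev_k1 : forall v, ev (vscale cubic_p1 v) = k1 *: ev v)
  (ev_kq : forall v, ev (vscale cubic_q v) = kq *: ev v)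
  (ev_kpq : forall v, ev (vscale cubic_pq v) = kpq *: ev v).

Lemma regular_relationsE w :
  [seq ev r | r <- regular_relations T w] =
  [seq F (ev [:: (w, c1)]) | F : {linear M -> M} <- regular_ops].
Proof.
rewrite /regular_relations; cbv zeta; rewrite !map_cons.
by rewrite !(ev_sub, ev_act, ev_k1, ev_kq, ev_kpq).
Qed.
End RegularOps.

Section RegularModule.
Variables (R : comNzRingType) (p : R) (q : Z -> R).
Hypothesis q0 : q Z0 = 1.
Hypothesis qD : forall i j, q (Z.add i j) = q i * q j.
Variable T : trie (seq vec).
Local Notation M := {malg R[word]}.
Local Notation ev := (veval p q (fun w => << w >> : M)).

(** The module is free on all words rather than on the normal ones, which avoids a subtype; the
    words outside the table are fixed by every letter. *)
Definition letter_op (x : nat) (m : M) : M :=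
  \sum_(w <- msupp m) m@_w *: ev (table_row T w x).

Lemma letter_opw (d : {fset word}) x m : (msupp m `<=` d)%fset ->
  letter_op x m = \sum_(w <- d) m@_w *: ev (table_row T w x).
Proof.
move=> led; rewrite /letter_op (big_fset_incl _ led) //=.
by move=> g _ /mcoeff_outdom ->; rewrite scale0r.
Qed.

Lemma letter_op_linear x : linear (letter_op x).
Proof.
move=> r m m'.
have le1 : (msupp (r *: m) `<=` msupp m `|` msupp m')%fset.
  by apply: fsubset_trans (fsubsetUl _ _); apply: msuppZ_le.
have le2 : (msupp (r *: m + m') `<=` msupp m `|` msupp m')%fset.
  by apply: fsubset_trans (msuppD_le _ _) _; rewrite fsubUset le1 fsubsetUr.
rewrite (letter_opw _ le2) (letter_opw _ (fsubsetUl _ (msupp m'))).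
rewrite (letter_opw _ (fsubsetUr (msupp m) _)) scaler_sumr -big_split /=.
by apply: eq_bigr => w _; rewrite mcoeffD mcoeffZ scalerDl scalerA.
Qed.

HB.instance Definition _ x :=
  GRing.isLinear.Build R M M *:%R (letter_op x) (letter_op_linear x).

Lemma letter_opU x w : letter_op x << w >> = ev (table_row T w x).
Proof. by rewrite (letter_opw _ msuppU_le) big_seq_fset1 mcoeffUU scale1r. Qed.

Lemma linear_malg0 (F : {linear M -> M}) :
  (forall w, F << w >> = 0) -> forall m, F m = 0.
Proof.
move=> F0 m; rewrite (monalgE m) linear_sum big1 // => w _.
have -> : << m@_w *g w >> = m@_w *: (<< w >> : M).
  by apply/malgP => u; rewrite mcoeffZ !mcoeffU mulr_natr.
by rewrite linearZ_LR F0 scaler0.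
Qed.

Lemma veval_vsum n l : ev (vsum n l) = \sum_(v <- l) ev v.
Proof.
have pairs k : forall s, (size s <= k)%N ->
    \sum_(v <- add_pairs s) ev v = \sum_(v <- s) ev v.
  elim: k => [|k IH] [|u [|v s]] // sk.
  by rewrite /= !big_cons veval_add // IH ?addrA // ltnW.
elim: n l => [|n IH] l.
  by elim: l => [|v l IH]; rewrite ?big_nil ?veval_nil // big_cons -IH -veval_add.
have IHn : ev (vsum n (add_pairs l)) = \sum_(v <- l) ev v.
  by rewrite IH; apply: (pairs (size l)).
by case: l IHn => [|v [|u l]] //=; rewrite big_seq1.
Qed.

Lemma veval_act x v : ev (act T x v) = letter_op x (ev v).
Proof.
rewrite veval_vsum big_map /= /veval linear_sum; apply: eq_bigr => t _.
rewrite [RHS]linearZ_LR [in RHS]/= letter_opU -veval_scale //; apply: qD.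
Qed.

Lemma veval_sub u v : ev (vsub u v) = ev u - ev v.
Proof.
rewrite veval_add veval_scale; last exact: qD.
by rewrite ceval_opp ?ceval1 ?scaleN1r //; apply: qD.
Qed.

Variable ws : seq word.
Hypothesis T_ws : forall w, w \notin ws -> lookup T w = None.
Hypothesis ws_check : regular_check T ws.

Definition malg_ops : seq {linear M -> M} :=
  regular_ops (fun x => letter_op x : {linear M -> M})
    (ceval p q cubic_p1) (ceval p q cubic_q) (ceval p q cubic_pq).

(** By linearity only basis words matter: those in [ws] are covered by the computed check, the
    others by [regular_ops_fix]. *)
Lemma malg_ops0 m : all (fun F : {linear M -> M} => F m == 0) malg_ops.
Proof.
apply/(all_nthP (lid M)) => i isz; apply/eqP; apply: linear_malg0 => {m} w.
suff /(all_nthP (lid M))/(_ i isz)/eqP :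
  all (fun F : {linear M -> M} => F << w >> == 0) malg_ops by [].
rewrite -(all_map (fun F : {linear M -> M} => F << w >>) (fun x => x == 0)).
have [wws|/T_ws wN] := boolP (w \in ws).
  case/andP: ws_check => /allP /(_ w wws) /allP nil_r _.
  have evZ f v : ev (vscale f v) = ceval p q f *: ev v by rewrite veval_scale.
  have := regular_relationsE (t := fun x => letter_op x : {linear M -> M})
    veval_act veval_sub (evZ _) (evZ _) (evZ _) w.
  rewrite veval1 // => <-; rewrite all_map; apply/allP => r /nil_r.
  by case: r => //= _; rewrite veval_nil.
rewrite [X in all _ X]regular_ops_fix ?all_nseq ?eqxx // => [x|].
  by rewrite [LHS]letter_opU /table_row wN veval1.
by rewrite ceval_cubic_p1 // ceval_cubic_q ceval_cubic_pq // addrA.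
Qed.
End RegularModule.

(** * From the relations between operators to the relators of Q_4 *)

Section RelatorCombinations.
Variables (R : comNzRingType) (M : lmodType R) (t : nat -> {linear M -> M}).
Variables a aV b c k1 kq kpq : R.
Hypothesis aK : a * aV = 1.
Let ops := regular_ops t k1 kq kpq.
Let V m w : M := (\prod_(x <- w) letter_scale aV a x) *: foldl (fun m x => t x m) m w.

Lemma quartic_combination m : nth (lid M) ops 10 m = 0 ->
  V m [:: 1; 2; 0]%N -
  (V m [:: 0; 2; 1]%N - aV *: V m [:: 0; 2]%N + a *: V m [:: 0; 3]%N
   + a *: V m [:: 1; 2]%N - a ^+ 3 *: V m [:: 1; 3]%N + aV *: V m [:: 2; 0]%N
   - a *: V m [:: 2; 1]%N - a *: V m [:: 3; 0]%N
   + a ^+ 3 *: V m [:: 3; 1]%N + a ^+ 2 *: V m [:: 1; 3; 0]%N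
   - a ^+ 2 *: V m [:: 0; 3; 1]%N) = 0.
Proof.
rewrite /= => /(congr1 ( *:%R a)); rewrite scaler0 => <-.
rewrite !(linearB (t _)) /V !big_cons !big_nil /letter_scale /=.
rewrite !(scalerBr, scalerDr) !scalerA !mulr1.
have aVK : aV * a = 1 by rewrite mulrC.
have -> : aV * (a * a) = a by ring: aK.
have -> : a * (a * aV) = a by ring: aK.
have -> : a * (aV * a) = a by ring: aK.
have -> : a ^+ 3 * (aV * aV) = a by ring: aK.
have -> : a ^+ 2 * (aV * (aV * a)) = a by ring: aK.
have -> : a ^+ 2 * (a * (aV * aV)) = a by ring: aK.
rewrite !(opprD, opprK) !addrA.
(* The factored relation expands to sixteen terms. The first twelve indices follow the order of the
   relator; the last four are the terms t_2 m and t_2^-1 m, each of which occurs with both signs and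
   cancels. *)
rewrite [RHS](ACl (1*9*13*15*5*7*2*10*4*12*3*11*6*14*16*8)%AC) /=.
by rewrite !addrK.
Qed.

(** [regular_ops] holds the cubic divided by t_1. Evaluation at t_1 m undoes the division, and the
    factor a^3 clears the denominators. *)
Lemma cubic_combination m : k1 = 1 + aV * (b + c) -> kq = aV ^+ 2 * (b * c) ->
  kpq = aV * (b + c) + aV ^+ 2 * (b * c) ->
  t 1 (t 0 m) = m -> nth (lid M) ops 9 (t 0 m) = 0 ->
  let f r x := V x [:: 0]%N - r *: x in f c (f b (f a m)) = 0.
Proof.
move=> k1E kqE kpqE t10 /=; rewrite t10 => /(congr1 ( *:%R (a ^+ 3))).
rewrite scaler0 => <-; rewrite /V !big_cons !big_nil /letter_scale /= !mulr1.
rewrite !(linearB (t _)) !(linearZ_LR (t _)) !(linearB (t _)) !(linearZ_LR (t _)).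
rewrite !(scalerBr, scalerDr) !scalerA.
have aVK : aV * a = 1 by rewrite mulrC.
have -> : a ^+ 3 * k1 = a * a * a + a * b * a + c * a * a by rewrite k1E; ring: aK.
have -> : a ^+ 3 * kpq = a * b * a + c * a * a + c * b * a by rewrite kpqE; ring: aK.
have -> : a ^+ 3 * kq = c * b * a by rewrite kqE; ring: aK.
have -> : a ^+ 3 = a * a * a by ring.
rewrite !scalerDl !(opprD, opprK) !addrA.
by rewrite [LHS](ACl (1*2*3*5*8*4*6*7)%AC).
Qed.
End RelatorCombinations.

Section QAction.
Variables (M : lmodType laurent) (t : nat -> {linear M -> M}).
Variables a aV k1 kq kpq : laurent.
Hypothesis aK : a * aV = 1.
Let ops := regular_ops t k1 kq kpq.
Hypothesis ops0 : forall m, all (fun F : {linear M -> M} => F m == 0) ops.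

Lemma op_rel i m : (i < 11)%N -> nth (lid M) ops i m = 0.
Proof. by move=> i11; have /(all_nthP (lid M))/(_ i i11)/eqP := ops0 m. Qed.

Definition letter_code (l : 'I_3 * bool) : nat := (l.1.*2 + ~~ l.2)%N.
Definition letter_weight (e : bool) : laurent := if e then a else aV.
(** Since s_i = a t_i, the weights are inverse to those of [scaled_letter]; this is why [weight]
    below is [letter_scale] with its arguments exchanged. *)
Definition braid_op (l : 'I_3 * bool) (m : M) : M :=
  letter_weight l.2 *: t (letter_code l) m.

Lemma braid_opD l : {morph braid_op l : x y / x + y}.
Proof. by move=> x y; rewrite /braid_op linearD scalerDr. Qed.

Lemma braid_opZ l r : {morph braid_op l : x / r *: x}.
Proof. by move=> x; rewrite /braid_op (linearZ_LR (t _)) !scalerA mulrC. Qed.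

Lemma letter_weightK e : letter_weight e * letter_weight (~~ e) = 1.
Proof. by case: e; rewrite /= ?aK // mulrC aK. Qed.

Lemma braid_opK (i : 'I_3) e m : braid_op (i, ~~ e) (braid_op (i, e) m) = m.
Proof.
rewrite /braid_op /= (linearZ_LR (t _)) scalerA mulrC letter_weightK scale1r.
apply: subr0_eq; case: i e => [[|[|[|//]]] i3] [].
- exact: (@op_rel 0 m).
- exact: (@op_rel 1 m).
- exact: (@op_rel 2 m).
- exact: (@op_rel 3 m).
- exact: (@op_rel 4 m).
- exact: (@op_rel 5 m).
Qed.

Lemma braid_op_artin (i j : 'I_3) m : j = i.+1 :> nat ->
  @word_act 4 M braid_op [:: (i, true); (j, true); (i, true)] m =
  @word_act 4 M braid_op [:: (j, true); (i, true); (j, true)] m.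
Proof.
have op3 (f g : {linear M -> M}) r :
    r *: f (r *: g (r *: f m)) = (r * r * r) *: f (g (f m)).
  by rewrite (linearZ_LR g) !(linearZ_LR f) !scalerA.
move=> ij; rewrite /word_act /braid_op /= !op3; congr (_ *: _).
apply: subr0_eq; rewrite /letter_code ij /=.
case: i ij (ltn_ord j) => [[|[|[|//]]] i3] /= ->  // _.
- exact: (@op_rel 7 m).
- exact: (@op_rel 8 m).
Qed.

Lemma braid_op_commute (i j : 'I_3) m : (i.+1 < j)%N ->
  braid_op (j, true) (braid_op (i, true) m) =
  braid_op (i, true) (braid_op (j, true) m).
Proof.
rewrite /braid_op /= (linearZ_LR (t _)) (linearZ_LR (t (letter_code (i, true)))).
move=> ij; congr (_ *: (_ *: _)).
case: i j ij => [[|[|[|//]]] i3] [[|[|[|//]]] j3] // _.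
by apply: subr0_eq; apply: (@op_rel 6 m).
Qed.

Let opA := @braid_act 4 M braid_op.
Let weight := letter_scale aV a.

Lemma braid_act_letter x m : (x < 6)%N ->
  opA (artin_letter 4 (letter_int x)) m = weight x *: t x m.
Proof.
have artE := @braid_act_artin 4 M braid_op braid_opK braid_op_artin braid_op_commute.
have artVE := @braid_act_artinV 4 M braid_op braid_opK braid_op_artin braid_op_commute.
move=> x6; have i3 : (x./2 < 3)%N.
  rewrite -ltn_double; apply: leq_ltn_trans x6.
  by rewrite -{2}[x]odd_double_half leq_addl.
have -> : t x m = t (x./2.*2 + odd x)%N m by rewrite addnC odd_double_half.
rewrite /opA /weight /letter_scale /letter_int; case: (odd x).
  exact: etrans (artVE _ i3 m) _.
exact: etrans (artE _ i3 m) _.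
Qed.

Lemma braid_act_letters w m : all (fun x => x < 6)%N w ->
  opA (artin_word 4 (map letter_int w)) m =
  (\prod_(x <- w) weight x) *: foldl (fun m x => t x m) m w.
Proof.
rewrite /opA (@braid_act_word 4 M braid_op braid_opK braid_op_artin braid_op_commute).
elim: w m => [|x w IH] m /=; first by rewrite big_nil scale1r.
case/andP=> x6 w6; rewrite big_cons -/opA braid_act_letter // IH //.
rewrite mulrC -scalerA; congr (_ *: _).
elim: w {IH w6} (t x m) => //= y w IH m'.
by rewrite (linearZ_LR (t y)) IH.
Qed.

Let ractA := @ring_act 4 M braid_op.
Let ractB := @ring_actB 4 M braid_op braid_opD braid_opZ braid_opK braid_op_artin
  braid_op_commute.
Let ractZ := @ring_actZ 4 M braid_op braid_opD braid_opZ braid_opK braid_op_artin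
  braid_op_commute.
Let ractM := @ring_actM 4 M braid_op braid_opD braid_opZ braid_opK braid_op_artin
  braid_op_commute.

Lemma ring_act_letters w m : all (fun x => x < 6)%N w ->
  ractA (rbw 4 (map letter_int w)) m =
  (\prod_(x <- w) weight x) *: foldl (fun m x => t x m) m w.
Proof. by move=> w6; rewrite -braid_act_letters // /ractA ring_act_rbw. Qed.

Variables b c : laurent.
Hypothesis k1E : k1 = 1 + aV * (b + c).
Hypothesis kqE : kq = aV ^+ 2 * (b * c).
Hypothesis kpqE : kpq = aV * (b + c) + aV ^+ 2 * (b * c).

Lemma cubic_act0 (x : RB 4) m :
  x = (rbw 4 [:: 1]%Z - a%:A) * (rbw 4 [:: 1]%Z - b%:A) * (rbw 4 [:: 1]%Z - c%:A) ->
  ractA x m = 0.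
Proof.
have ractE r m' : ractA (rbw 4 [:: 1]%Z - r%:A) m' =
    (\prod_(x <- [:: 0%N]) weight x) *: t 0 m' - r *: m'.
  apply: etrans (ractB _ _ _) _; congr (_ - _); last first.
    exact: (@ring_act_scalar 4 M braid_op braid_opD braid_opZ braid_opK braid_op_artin
      braid_op_commute).
  exact: (@ring_act_letters [:: 0%N] m').
move=> ->; apply: etrans (ractM _ _ _) _; rewrite [LHS]ractE.
have -> : @ring_act 4 M braid_op ((rbw 4 [:: 1]%Z - a%:A) * (rbw 4 [:: 1]%Z - b%:A)) m =
  ractA (rbw 4 [:: 1]%Z - b%:A) (ractA (rbw 4 [:: 1]%Z - a%:A) m) by exact: ractM.
rewrite !ractE; apply: (cubic_combination aK k1E kqE kpqE).
  by apply: subr0_eq; apply: (@op_rel 0 m).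
exact: (@op_rel 9 (t 0 m)).
Qed.

Lemma quartic_act0 m : a = lau_a -> aV = lau_aV ->
  ractA (quartic_relator 4) m = 0.
Proof.
move=> aE aVE.
have LB := linear_morphB (f := fun x => ractA x m) (fun x y => ractB x y m)
  (fun r x => ractZ r x m).
have LD := linear_morphD (f := fun x => ractA x m) (fun x y => ractB x y m)
  (fun r x => ractZ r x m).
apply: etrans (quartic_combination aK (@op_rel 10 m isT)).
rewrite /quartic_relator -aE -aVE.
apply: etrans (ractB _ _ _) _; congr (_ - _).
  exact: (@ring_act_letters [:: 1; 2; 0]%N m).
apply: (LB); last exact: (@ring_act_letters [:: 0; 3; 1]%N m).
apply: (LD); last exact: (@ring_act_letters [:: 1; 3; 0]%N m).
apply: (LD); last exact: (@ring_act_letters [:: 3; 1]%N m).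
apply: (LB); last exact: (@ring_act_letters [:: 3; 0]%N m).
apply: (LB); last exact: (@ring_act_letters [:: 2; 1]%N m).
apply: (LD); last exact: (@ring_act_letters [:: 2; 0]%N m).
apply: (LB); last exact: (@ring_act_letters [:: 1; 3]%N m).
apply: (LD); last exact: (@ring_act_letters [:: 1; 2]%N m).
apply: (LD); last exact: (@ring_act_letters [:: 0; 3]%N m).
apply: (LB); last exact: (@ring_act_letters [:: 0; 2]%N m).
exact: (@ring_act_letters [:: 0; 2; 1]%N m).
Qed.
End QAction.

(** The product of the scaled letters, as [tword_wprod] confirms, written without an algebra
    structure on Q_4: that structure requires Q_4 to be nonzero, which is deduced from the
    functional constructed next. *)
Definition tword (w : word) : Q 4 :=
  (\prod_(x <- w) letter_scale lau_a lau_aV x) *: qw 4 (map letter_int w).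

Lemma letter_scaleK (R : comNzRingType) (a aV : R) (w : word) : a * aV = 1 ->
  (\prod_(x <- w) letter_scale a aV x) * (\prod_(x <- w) letter_scale aV a x) = 1.
Proof.
move=> aK; rewrite -big_split big1 // => x _.
by rewrite /letter_scale; case: ifP => _; [|apply: etrans (mulrC _ _) _]; exact: aK.
Qed.

Lemma regular_functional (T : trie (seq vec)) (ws : seq word) :
    (forall w, w \notin ws -> lookup T w = None) -> regular_check T ws ->
    all (all (fun x => x < 6)%N) ws ->
  exists f : Q 4 -> {malg laurent[word]},
    [/\ {morph f : x y / x + y}, forall r, {morph f : x / r *: x} &
        {in ws, forall w, f (tword w) = << w >>}].
Proof.
move=> T_ws T_check ws6.
pose t x : {linear {malg laurent[word]} -> {malg laurent[word]}} :=
  letter_op lau_p lau_q T x.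
have ops0 m := @malg_ops0 laurent lau_p lau_q lau_q0 lau_qD T ws T_ws T_check m.
have k1E := @ceval_cubic_p1 laurent lau_p lau_q lau_q0.
have kqE : ceval lau_p lau_q cubic_q = lau_aV ^+ 2 * (lau_b * lau_c).
  by rewrite ceval_cubic_q lau_q1.
have kpqE : ceval lau_p lau_q cubic_pq =
    lau_aV * (lau_b + lau_c) + lau_aV ^+ 2 * (lau_b * lau_c).
  by rewrite (@ceval_cubic_pq laurent lau_p lau_q lau_q0) lau_q1.
pose op := braid_op t lau_a lau_aV.
have rel0 m : @ring_act 4 _ op (cubic_relator 4) m = 0 /\
    @ring_act 4 _ op (quartic_relator 4) m = 0.
  split; first exact: (cubic_act0 lau_aK ops0 k1E kqE kpqE).
  exact: (quartic_act0 lau_aK ops0).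
have op_D := braid_opD t lau_a lau_aV.
have op_Z := braid_opZ t lau_a lau_aV.
have op_K := braid_opK lau_aK ops0.
have op_A := braid_op_artin lau_a lau_aV ops0.
have op_C := braid_op_commute lau_a lau_aV ops0.
exists (fun x => @Q_act 4 _ op x << [::] >>); split.
- by move=> x y; apply: (@Q_actD 4 _ op op_D op_Z op_K op_A op_C rel0).
- by move=> r x; apply: (@Q_actZ 4 _ op op_D op_Z op_K op_A op_C rel0).
move=> w wws.
have w6 : all (fun x => x < 6)%N w by apply: (allP ws6).
rewrite /tword [LHS](@Q_actZ 4 _ op op_D op_Z op_K op_A op_C rel0).
rewrite [X in _ *: X](@Q_act_qw 4 _ op op_D op_Z op_K op_A op_C rel0).
rewrite [X in _ *: X](braid_act_letters lau_aK ops0 _ w6).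
rewrite scalerA letter_scaleK ?lau_aK // scale1r.
pose ev := veval lau_p lau_q (fun w => << w >> : {malg laurent[word]}).
have foldE v : ev (foldl (fun v x => act T x v) v w) =
    foldl (fun m x => t x m) (ev v) w.
  elim: w {wws w6} v => //= x w IH v.
  by rewrite IH; congr foldl; apply: veval_act; apply: lau_qD.
case/andP: T_check => _ /allP/(_ w wws).
case E: (vsub _ _) => [|//] _; have := @veval_sub laurent lau_p lau_q lau_q0 lau_qD
  (foldl (fun v x => act T x v) [:: ([::], c1)] w) [:: (w, c1)].
rewrite E veval_nil => /esym/subr0_eq; rewrite -/ev foldE.
by rewrite /ev !(@veval1 laurent lau_p lau_q lau_q0).
Qed.

(** * Spanning families *)

Section Span.
Variables (R : comPzRingType) (V : lmodType R).
Implicit Types (s : seq V) (v : V).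

(** Coefficients are indexed by [nat], unlike in [is_basis], so that the size of the list can be
    rewritten freely. *)
Definition spanned s v : Prop :=
  exists c : nat -> R, v = \sum_(i < size s) c i *: s`_i.

Definition submod (P : V -> Prop) : Prop :=
  [/\ P 0, forall x y, P x -> P y -> P (x + y) & forall r x, P x -> P (r *: x)].

Lemma submod_sum (P : V -> Prop) (I : Type) (r : seq I) (p : pred I) (F : I -> V) :
  submod P -> (forall i, p i -> P (F i)) -> P (\sum_(i <- r | p i) F i).
Proof. by case=> P0 PD _ PF; apply: (big_ind P). Qed.

Lemma spanned_submod s : submod (spanned s).
Proof.
split=> [|x y [c ->] [d ->]|r x [c ->]].
- by exists (fun=> 0); rewrite big1 // => i _; rewrite scale0r.
- exists (fun i => c i + d i); rewrite -big_split /=.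
  by apply: eq_bigr => i _; rewrite scalerDl.
- exists (fun i => r * c i); rewrite scaler_sumr.
  by apply: eq_bigr => i _; rewrite scalerA.
Qed.

Lemma spanned_mem s v : v \in s -> spanned s v.
Proof.
move=> vs; have iP : (index v s < size s)%N by rewrite index_mem.
exists (fun i => (i == index v s)%:R).
rewrite (bigD1 (Ordinal iP)) //= eqxx scale1r nth_index // big1 ?addr0 // => i.
by rewrite -val_eqE /= => /negPf ->; rewrite scale0r.
Qed.

Lemma spanned_min s (P : V -> Prop) : submod P -> {in s, forall v, P v} ->
  forall v, spanned s v -> P v.
Proof.
move=> Psub Ps _ [c ->]; apply: submod_sum => // i _.
by case: Psub => _ _; apply; apply: Ps; apply: mem_nth.
Qed.

Lemma is_basis_spanned s : is_basis s -> forall v, spanned s v.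
Proof.
case=> span _ v; have [c ->] := span v.
exists (fun i => if insub i is Some j then c j else 0).
by apply: eq_bigr => i _; rewrite valK.
Qed.

(** Each family is expressed in the other by a square matrix, and freeness of [s0] gives
    [mD *m mC = 1]. Over a commutative ring a one-sided inverse of a square matrix is two-sided. A
    relation c on [s] gives [mc *m mC = 0], again by freeness of [s0], and multiplying by [mD] gives
    c = 0. *)
Lemma spanning_is_basis s0 s :
  size s = size s0 -> (forall v, spanned s0 v) ->
  (forall c : nat -> R, \sum_(i < size s0) c i *: s0`_i = 0 ->
     forall i, (i < size s0)%N -> c i = 0) ->
  (forall v, spanned s v) -> is_basis s.
Proof.
move=> sz span0 free0 span; split=> [v|c c0 i].
  by have [c ->] := span v; exists (fun i => c i).
have {}span0 v : exists c : nat -> R, v = \sum_(i < size s) c i *: s0`_i.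
  by rewrite sz; apply: span0.
have {}free0 (d : nat -> R) : \sum_(i < size s) d i *: s0`_i = 0 ->
    forall i, (i < size s)%N -> d i = 0.
  by rewrite sz; apply: free0.
have [C sC] := boolp.choice (fun i : nat => span0 s`_i).
have [D sD] := boolp.choice (fun i : nat => span s0`_i).
pose n := size s; pose mC := \matrix_(i < n, j < n) C i j.
pose mD := \matrix_(i < n, j < n) D i j; pose mc := \row_(i < n) c i.
have combine (u v : nat -> V) (x : 'I_n -> R) (E : nat -> nat -> R) :
    (forall i, u i = \sum_(j < n) E i j *: v j) ->
    \sum_(i < n) x i *: u i =
    \sum_(j < n) ((\row_i x i) *m \matrix_(i, j) E i j) 0 j *: v j.
  move=> uv; under [RHS]eq_bigr => j _ do rewrite mxE scaler_suml.
  rewrite exchange_big /=; apply: eq_bigr => k _; rewrite uv scaler_sumr.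
  by apply: eq_bigr => j _; rewrite !mxE scalerA.
have toN (x : 'rV[R]_n) : \sum_(j < n) x 0 j *: s0`_j = 0 -> x = 0.
  move=> x0; apply/rowP => j; rewrite mxE.
  pose d k := if insub k is Some j then x 0 j else 0.
  have dE (k : 'I_n) : d k = x 0 k by rewrite /d valK.
  rewrite -dE; apply: free0 (ltn_ord j); rewrite -[RHS]x0.
  by apply: eq_bigr => k _; rewrite dE.
have DC : mD *m mC = 1%:M.
  apply/row_matrixP => k; apply/eqP; rewrite -subr_eq0; apply/eqP; apply: toN.
  have rowE j : (row k (mD *m mC) - row k 1%:M) 0 j =
      (row k mD *m mC) 0 j - (1%:M : 'M_n) k j by rewrite -row_mul !mxE.
  under eq_bigr => j _ do rewrite rowE scalerBl.
  rewrite big_split /= sumrN; apply/eqP; rewrite subr_eq0; apply/eqP.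
  have := combine (fun i => s`_i) (fun i => s0`_i) (fun i => mD k i) C sC.
  have -> : \row_i mD k i = row k mD by apply/rowP => j; rewrite !mxE.
  move=> <-; under eq_bigr => j _ do rewrite mxE.
  rewrite -sD (bigD1 k) //= !mxE eqxx scale1r big1 ?addr0 // => j jk.
  by rewrite !mxE eq_sym (negPf jk) scale0r.
have CD := mulmx1C DC.
have : mc *m mC = 0.
  by apply: toN; rewrite -(combine (fun i => s`_i) (fun i => s0`_i) c C sC).
move=> /(congr1 (mulmx^~ mD)); rewrite -mulmxA CD mulmx1 mul0mx => /rowP/(_ i).
by rewrite !mxE.
Qed.
End Span.

Section Tabulate.
Variables (D : Type) (f : word -> D) (ws : seq word).

Lemma lookup_tabulate w :
  lookup (tabulate f ws) w = if w \in ws then Some (f w) else None.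
Proof.
elim: ws => [|u us IH] /=; first exact: lookup_Leaf.
by rewrite lookup_insert inE eq_sym; case: eqP => [->|].
Qed.

Lemma known_tabulate w : known (tabulate f ws) w = (w \in ws).
Proof. by rewrite /known lookup_tabulate; case: ifP. Qed.
End Tabulate.

Lemma normal_wordsS D (t : trie D) n ws : normal_words t n.+1 ws =
  ws ++ normal_words t n [seq w <- [seq rcons w x | w <- ws, x <- letters] |
    if find_factor t w is None then true else false].
Proof. by []. Qed.

Lemma normal_words_letters D (t : trie D) n ws :
  all (all (fun x => x < 6)%N) ws ->
  all (all (fun x => x < 6)%N) (normal_words t n ws).
Proof.
elim: n ws => [//|n IH] ws ws6.
rewrite normal_wordsS all_cat ws6; apply: IH.
apply/allP => v; rewrite mem_filter => /andP[_ /allpairsP[[w x] /= [wws x6 ->]]].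
by rewrite all_rcons (allP ws6) // andbT; move: x6; rewrite mem_iota.
Qed.

(** The existential replaces the fuel and the computed rules by variables, so that no later
    conversion can unfold the computation. The fuel 2^14 bounds the steps of each single
    reduction. *)
Lemma rules_checked : exists n t,
  t = complete n steps Leaf [::] /\ rules_check n t.
Proof.
exists (Nat.pow 2 14), (complete (Nat.pow 2 14) steps Leaf [::]).
by split; [reflexivity | vm_compute; reflexivity].
Qed.

Lemma malg_free (R : nzRingType) (K : choiceType) (x0 : K) (s : seq K)
    (c : nat -> R) : uniq s ->
  \sum_(i < size s) c i *: (<< nth x0 s i >> : {malg R[K]}) = 0 ->
  forall i, (i < size s)%N -> c i = 0.
Proof.
move=> s_uniq c0 i i_s.
transitivity ((\sum_(i < size s) c i *: (<< nth x0 s i >> : {malg R[K]}))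
                @_(nth x0 s i)).
  rewrite raddf_sum (bigD1 (Ordinal i_s)) //= mcoeffZ mcoeffUU mulr1.
  rewrite big1 ?addr0 // => j ji; rewrite mcoeffZ mcoeffU nth_uniq //.
  by rewrite -val_eqE /= in ji; rewrite (negPf ji) mulr0.
by rewrite c0 mcoeff0.
Qed.

Section QSpan.
Variables (n : nat) (t : trie vec).
Hypothesis t_def : t = complete n steps Leaf [::].
Hypothesis t_check : rules_check n t.

Let ws := normal_words t 8 [:: [::]].
Let T := regular_table n t ws.

Lemma tword0 : tword [::] = qw 4 [::].
Proof. by rewrite /tword big_nil scale1r. Qed.

Lemma Q4_functional : exists f : Q 4 -> {malg laurent[word]},
    [/\ {morph f : x y / x + y}, forall r, {morph f : x / r *: x} &
        {in ws, forall w, f (tword w) = << w >>}].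
Proof.
case/and5P: t_check => _ _ _ Tck _; apply: regular_functional Tck _ => [w wN|].
  by rewrite /T lookup_tabulate (negPf wN).
exact: normal_words_letters.
Qed.

Lemma tword_free (c : nat -> laurent) :
  \sum_(i < size ws) c i *: tword (nth [::] ws i) = 0 ->
  forall i, (i < size ws)%N -> c i = 0.
Proof.
have [f [fD fZ fT]] := Q4_functional => c0 i iw.
have f0 : f 0 = 0 by rewrite -(scale0r 0) fZ scale0r.
case/and5P: t_check => _ uniq_ws _ _ _.
apply: (malg_free (x0 := [::] : word) uniq_ws) iw.
apply: etrans (etrans (congr1 f c0) f0).
rewrite [RHS](big_morph f fD f0); apply: eq_bigr => j _.
by rewrite [RHS]fZ fT ?mem_nth.
Qed.

Lemma Q4_nonzero : (1 : Q 4) != 0.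
Proof.
have [f [fD fZ fT]] := Q4_functional.
apply/eqP => q10; have : f (tword [::]) = 0.
  have -> : tword [::] = 0 *: tword [::].
    by rewrite scale0r tword0 -q10 /qw /rbw /artin_word big_nil.
  by rewrite fZ scale0r.
rewrite fT; first by move=> /eqP; rewrite monalgU_eq0 oner_eq0.
by rewrite /ws normal_wordsS mem_cat mem_seq1.
Qed.
End QSpan.

(** * The normal words span Q_4 *)

Section QWords.
Variable n : nat.

Lemma qw_cat u v : qw n (u ++ v) = qw n u * qw n v.
Proof.
apply/esym/(etrans (quot_mul_pi _ _ _)); rewrite /qw /rbw.
congr (\pi_(_) _)%qT; apply: etrans (gr_mulUU _ _ _ _) _.
by rewrite mulr1 /artin_word big_cat.
Qed.

Lemma qw0 : qw n [::] = 1.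
Proof. by rewrite /qw /rbw /artin_word big_nil. Qed.

Lemma eq_qw u v : artin_word n u = artin_word n v -> qw n u = qw n v.
Proof. by rewrite /qw /rbw => ->. Qed.

Lemma braid_piM u v :
  ((\pi_(braid_group n) u)%qT * (\pi_(braid_group n) v)%qT)%g =
  (\pi_(braid_group n) (u ++ v))%qT :> braid_group n.
Proof. exact: braid_mul_pi. Qed.

Lemma artin_braid i : (i.+1 < n.-1)%N ->
  (artin n i.+1 * artin n i.+2 * artin n i.+1 =
   artin n i.+2 * artin n i.+1 * artin n i.+2)%g.
Proof.
move=> lin; rewrite (artin_ord lin) (artin_ord (ltnW lin)).
rewrite !braid_piM.
by apply/braid_piP; apply: BraidArtin.
Qed.

Lemma artin_commute i j : (i.+1 < j < n.-1)%N ->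
  (artin n i.+1 * artin n j.+1 = artin n j.+1 * artin n i.+1)%g.
Proof.
case/andP=> ij jn; rewrite (artin_ord jn) (artin_ord (ltn_trans (ltnW ij) jn)).
rewrite !braid_piM.
by apply/braid_piP; apply: BraidCommute.
Qed.

Lemma Q_pi0 : (\pi_(Q n) 0)%qT = 0.
Proof.
apply: (@addrI _ (\pi_(Q n) 0)%qT); rewrite addr0.
by apply: etrans (esym (quot_piD _ _ _)) _; rewrite addr0.
Qed.

Lemma Q_pi_relator x : @Q_relators n x -> (\pi_(Q n) x)%qT = 0.
Proof.
move=> xR; rewrite -Q_pi0; apply/quot_algP; rewrite subr0; exact: GenIdealIn.
Qed.
End QWords.

Lemma Q4_neq0 : (1 : Q 4) != 0.
Proof. by have [n [t [tE tC]]] := rules_checked; apply: Q4_nonzero tC. Qed.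

(* [lalgType] requires a nonzero ring, hence this copy of [Q 4] once the regular
   representation has shown that it is nonzero. *)
Definition Q4 : Type := Q 4.
HB.instance Definition _ := GRing.PzRing.copy Q4 (Q 4).
HB.instance Definition _ := GRing.Lmodule.copy Q4 (Q 4).
HB.instance Definition _ := GRing.PzSemiRing_isNonZero.Build Q4 Q4_neq0.

Lemma Q4_scaleAl (r : laurent) (x y : Q4) : r *: (x * y) = (r *: x) * y.
Proof. exact: quot_scaleAl. Qed.
HB.instance Definition _ :=
  GRing.Lmodule_isLalgebra.Build laurent Q4 Q4_scaleAl.

Lemma Q4_scaleAr (r : laurent) (x y : Q4) : r *: (x * y) = x * (r *: y).
Proof. exact: quot_scaleAr. Qed.
HB.instance Definition _ :=
  GRing.Lalgebra_isAlgebra.Build laurent Q4 Q4_scaleAr.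

Lemma qw4_cat u v : (qw 4 (u ++ v) : Q4) = (qw 4 u : Q4) * (qw 4 v : Q4).
Proof. exact: qw_cat. Qed.

Lemma qw4_0 : (qw 4 [::] : Q4) = 1.
Proof. exact: qw0. Qed.

(** * The defining relations inside Q_4 *)

Section Q4Relations.
Let pi4 (x : RB 4) : Q4 := (\pi_(Q 4) x)%qT.

Let pi4M : {morph pi4 : x y / x * y}.
Proof. by move=> x y; apply: esym; apply: quot_mul_pi. Qed.

Let pi4Z r : {morph pi4 : x / r *: x}.
Proof. by move=> x; apply: esym; apply: quot_scale_pi. Qed.

Let pi4B : {morph pi4 : x y / x - y}.
Proof.
move=> x y; rewrite -[- y]scaleN1r; apply: etrans (quot_piD _ _ _) _.
by congr (_ + _); rewrite -[RHS]scaleN1r; apply: pi4Z.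
Qed.

Lemma Q4_cubic (W := qw 4 : seq int -> Q4) :
  (W [:: 1]%Z - lau_a%:A) * (W [:: 1]%Z - lau_b%:A) * (W [:: 1]%Z - lau_c%:A) = 0.
Proof.
have pi1 : pi4 1 = 1 by [].
rewrite -(cubic_morph pi4B pi4M pi4Z pi1).
by apply: Q_pi_relator; left.
Qed.

Lemma Q4_quartic (W := qw 4 : seq int -> Q4) :
  W [:: -1; 2; 1]%Z -
  (W [:: 1; 2; -1]%Z - lau_aV *: W [:: 1; 2]%Z + lau_a *: W [:: 1; -2]%Z
   + lau_a *: W [:: -1; 2]%Z - lau_a ^+ 3 *: W [:: -1; -2]%Z
   + lau_aV *: W [:: 2; 1]%Z - lau_a *: W [:: 2; -1]%Z
   - lau_a *: W [:: -2; 1]%Z + lau_a ^+ 3 *: W [:: -2; -1]%Z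
   + lau_a ^+ 2 *: W [:: -1; -2; 1]%Z
   - lau_a ^+ 2 *: W [:: 1; -2; -1]%Z) = 0.
Proof.
have LB := linear_morphB pi4B pi4Z; have LD := linear_morphD pi4B pi4Z.
have : pi4 (quartic_relator 4) = 0 by apply: Q_pi_relator; right.
move=> <-; rewrite /quartic_relator; apply: etrans (esym (pi4B _ _)).
congr (_ - _); apply: esym.
by do 10![(apply: (LB) || apply: (LD)); last by []].
Qed.
End Q4Relations.

Lemma eq_qw4 u v : artin_word 4 u = artin_word 4 v -> (qw 4 u : Q4) = qw 4 v.
Proof. exact: eq_qw. Qed.

Lemma artin_wordE n (u : seq int) :
  artin_word n u = foldr (fun i g => artin_letter n i * g)%g 1%g u.
Proof. by rewrite /artin_word unlock. Qed.

Section CoxeterElement.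
Local Open Scope group_scope.
Variables (G : groupType) (s1 s2 s3 : G).
Hypotheses (b12 : s1 * s2 * s1 = s2 * s1 * s2) (b23 : s2 * s3 * s2 = s3 * s2 * s3).
Hypothesis c13 : s1 * s3 = s3 * s1.

(** The element s_1 s_2 s_3 conjugates s_1 to s_2 and, in the next lemma, s_2 to s_3. Here the last
    s_1 passes s_3 and then takes part in one braid move. *)
Lemma coxeter_shift1 : s1 * s2 * s3 * s1 = s2 * (s1 * s2 * s3).
Proof. by rewrite -(mulgA (s1 * s2)) -c13 !mulgA b12. Qed.

Lemma coxeter_shift2 : s1 * s2 * s3 * s2 = s3 * (s1 * s2 * s3).
Proof. by rewrite -!mulgA (mulgA s2) b23 !mulgA c13. Qed.

Lemma shift_inv (d x y : G) : d * x = y * d -> d * x^-1 = y^-1 * d.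
Proof. by move=> dx; apply: (mulgI y); rewrite mulgA -dx mulgK mulVKg. Qed.
End CoxeterElement.

Section Q4Rules.
Local Notation W := (qw 4 : seq int -> Q4).
Local Notation g := (scaled_letter lau_a lau_aV W).
Local Notation ev := (veval lau_p lau_q (wprod g)).

Let D : Q4 := W [:: 1; 2; 3]%Z.

Lemma Q4_shift x : (x < 4)%N ->
  D * W [:: letter_int x] = W [:: letter_int x.+2] * D.
Proof.
have b12 := @artin_braid 4 0 isT; have b23 := @artin_braid 4 1 isT.
have c13 := @artin_commute 4 0 2 isT.
have sh1 := coxeter_shift1 b12 c13; have sh2 := coxeter_shift2 b23 c13.
move=> x4; rewrite -!qw4_cat; apply: eq_qw4; rewrite !artin_wordE /= !mulg1 !mulgA.
case: x x4 => [|[|[|[|//]]]] _ /=.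
- by rewrite sh1 !mulgA.
- by rewrite (shift_inv sh1) !mulgA.
- by rewrite sh2 !mulgA.
- by rewrite (shift_inv sh2) !mulgA.
Qed.

Lemma Q4_DE : D * W [:: -3; -2; -1]%Z = 1.
Proof.
rewrite -qw4_cat -qw4_0; apply: eq_qw4; rewrite !artin_wordE /= mulg1.
by rewrite !mulgA !mulgK mulgV.
Qed.

Lemma Q4_word_eq (u v : word) :
  \prod_(x <- u) letter_scale lau_a lau_aV x =
    \prod_(x <- v) letter_scale lau_a lau_aV x ->
  artin_word 4 (map letter_int u) = artin_word 4 (map letter_int v) ->
  ev [:: (u, c1); (v, cN1)] = 0.
Proof.
move=> sc uv; apply: veval_binomial; [exact: lau_q0 | exact: lau_qD |].
rewrite !(wprod_scaled _ _ qw4_0 qw4_cat) sc; congr (_ *: _); exact: eq_qw4.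
Qed.

Lemma Q4_cancel : ev cancel_rel = 0.
Proof.
apply: Q4_word_eq; first by rewrite !big_cons !big_nil mulr1 mulrC; apply: lau_aK.
by rewrite !artin_wordE /= mulg1 mulgV.
Qed.

Lemma Q4_cancel' : ev cancel_rel' = 0.
Proof.
apply: Q4_word_eq; first by rewrite !big_cons !big_nil mulr1; apply: lau_aK.
by rewrite !artin_wordE /= mulg1 mulVg.
Qed.

Lemma Q4_artin : ev artin_rel = 0.
Proof.
apply: Q4_word_eq; first by rewrite !big_cons !big_nil.
rewrite !artin_wordE /= !mulg1 !mulgA.
by rewrite -(@artin_braid 4 0 isT).
Qed.

Lemma Q4_commute : ev commute_rel = 0.
Proof.
apply: Q4_word_eq; first by rewrite !big_cons !big_nil.
rewrite !artin_wordE /= !mulg1.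
by rewrite -(@artin_commute 4 0 2 isT).
Qed.

Lemma Q4_rel_shift v : all (fun t => all (fun x => x < 4)%N t.1) v ->
  ev v = 0 -> ev (vshift v) = 0.
Proof. exact: (veval_shift Q4_DE Q4_shift). Qed.

Lemma Q4_cubic_rel : ev cubic_rel = 0.
Proof.
apply: (veval_cubic lau_aK lau_q0 lau_q1 qw4_0 qw4_cat _ Q4_cubic).
rewrite -qw4_cat -qw4_0; apply: eq_qw4.
by rewrite !artin_wordE /= mulg1 mulgV.
Qed.

Lemma Q4_quartic_rel : ev quartic_rel = 0.
Proof.
exact: (veval_quartic lau_b lau_c lau_aK lau_q0 lau_qD qw4_0 qw4_cat Q4_quartic).
Qed.

Lemma Q4_givens s : List.In s steps -> sound_step lau_p lau_q g s.
Proof.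
have ov : all (fun s => if s is Given _ then false else true) overlaps by [].
have ov_sound o os : all (fun s => if s is Given _ then false else true) os ->
    List.In o os -> sound_step lau_p lau_q g o.
  by elim: os => // o' os IH /= /andP[o1 /IH{}IH] [<-|//]; case: o' o1.
case/(List.in_app_or (map Given givens)) => [|/(ov_sound _ _ ov)//].
have sh := Q4_rel_shift.
have r1 := Q4_cancel; have r2 := Q4_cancel'; have r3 := Q4_cubic_rel.
have r1s := sh cancel_rel isT r1; have r2s := sh cancel_rel' isT r2.
have r3s := sh cubic_rel isT r3.
case=> [<-|]; first exact: r1.
case=> [<-|]; first exact: r2.
case=> [<-|]; first exact: r3.
case=> [<-|]; first exact: r1s.
case=> [<-|]; first exact: r2s.
case=> [<-|]; first exact: r3s.
case=> [<-|]; first exact: (sh (vshift cancel_rel) isT r1s).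
case=> [<-|]; first exact: (sh (vshift cancel_rel') isT r2s).
case=> [<-|]; first exact: (sh (vshift cubic_rel) isT r3s).
case=> [<-|]; first exact: Q4_commute.
case=> [<-|]; first exact: Q4_artin.
case=> [<-|]; first exact: Q4_quartic_rel.
case=> [<-|]; first exact: (sh artin_rel isT Q4_artin).
by case=> [<-|//]; exact: (sh quartic_rel isT Q4_quartic_rel).
Qed.

Lemma Q4_rules_sound n : sound_trie lau_p lau_q g (complete n steps Leaf [::]).
Proof.
apply: sound_complete;
  [exact: lau_q0 | exact: lau_qD | exact: Q4_givens | exact: sound_Leaf |].
by move=> i; rewrite nth_nil veval_nil.
Qed.

End Q4Rules.

Lemma veval_split (R : comNzRingType) (p : R) (q : Z -> R) (M : lmodType R)
    (e : word -> M) (a : pred (word * coef)) v :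
  veval p q e v =
  veval p q e [seq u <- v | a u] + veval p q e [seq u <- v | ~~ a u].
Proof. by rewrite /veval (bigID a) !big_filter. Qed.

Section Closure.
Local Notation W := (qw 4 : seq int -> Q4).
Local Notation g := (scaled_letter lau_a lau_aV W).
Local Notation wp := (wprod g).
Local Notation ev := (veval lau_p lau_q wp).
Variables (n : nat) (t : trie vec).
Hypothesis t_def : t = complete n steps Leaf [::].
Hypothesis t_check : rules_check n t.

Let ws := normal_words t 8 [:: [::]].

Let t_sound : sound_trie lau_p lau_q g t.
Proof. rewrite t_def; exact: Q4_rules_sound. Qed.

Lemma tword_wprod w : tword w = wp w.
Proof. by rewrite (wprod_scaled lau_a lau_aV qw4_0 qw4_cat). Qed.

Lemma veval_submod (Q : Q4 -> Prop) v : submod Q ->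
  (forall u, u \in v -> Q (wp u.1)) -> Q (ev v).
Proof.
move=> Qs Qv; rewrite /veval big_seq; apply: submod_sum => // u uv.
by case: Qs => _ _; apply; apply: Qv.
Qed.

Lemma normal_closed (P : Q4 -> Prop) : submod P ->
  {in ws, forall w, P (wp w)} ->
  forall u, all (fun x => x < 6)%N u -> P (wp u).
Proof.
move=> Ps Pws u; elim/last_ind: u P Ps Pws => [|u x IH] Q [Q0 QD QZ] Qws.
  by move=> _; apply: Qws; rewrite /ws normal_wordsS mem_cat mem_seq1.
rewrite all_rcons => /andP[x6 u6]; rewrite -cats1 wprod_cat.
(* The elements whose product with the last letter lies in [Q] again form a submodule. To apply the
   induction hypothesis to it, only products of a normal word with one letter have to be examined,
   and the closed table supplies these. *)
apply: (IH (fun y => Q (y * wp [:: x]))) => //.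
  split=> [|y z Qy Qz|r y Qy]; first by rewrite mul0r.
    by rewrite mulrDl; apply: QD.
  by rewrite -scalerAl; apply: QZ.
move=> w wws; rewrite -wprod_cat cats1.
have -> : wp (rcons w x) = ev (reduce n t [:: (rcons w x, c1)]).
  rewrite (veval_reduce lau_qD) //; apply: esym.
  exact: (@veval1 laurent lau_p lau_q lau_q0).
case/and5P: t_check => _ _ /allP/(_ w wws)/allP/(_ x) cl _ _.
have {cl} /allP cl : all (fun u => known (regular_table n t ws) u.1)
    (table_row (regular_table n t ws) w x) by apply: cl; rewrite mem_iota.
apply: veval_submod => // u' u'v; apply: Qws.
have -> : (u'.1 \in ws) = known (regular_table n t ws) u'.1.
  by rewrite known_tabulate.
apply: cl; rewrite /table_row lookup_tabulate wws.
by rewrite (nth_map 0%N) ?size_iota // nth_iota.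
Qed.

(** In the normal form of [d] every word but one is already in [Q], and so is [d]. The remaining
    word has a unit coefficient and can be solved for. *)
Lemma saturateP (Q : Q4 -> Prop) K ds : submod Q ->
  (forall w, known K w -> Q (wp w)) -> {in ds, forall d, Q (wp d)} ->
  forall w, known (saturate n t K ds) w -> Q (wp w).
Proof.
move=> Qs; have [Q0 QD QZ] := Qs.
elim: ds K => [//|d ds IH] K QK Qds /=.
case E: [seq _ <- _ | _] => [|[w c] [|u s]] //.
case F: (cunitV c) => [c'|//]; apply: IH => [w'|d' d'ds]; last first.
  by apply: Qds; rewrite inE d'ds orbT.
rewrite /known lookup_insert; case: eqP => [<- _|_]; last exact: QK.
set v := reduce n t [:: (d, c1)] in E.
have dv : wp d = ev v.
  rewrite (veval_reduce lau_qD) //; apply: esym.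
  exact: (@veval1 laurent lau_p lau_q lau_q0).
have ev_split : ev v = ev [seq u <- v | known K u.1] + ceval lau_p lau_q c *: wp w.
  rewrite (veval_split _ _ _ (fun u => known K u.1)) E; congr (_ + _).
  by rewrite veval_cons veval_nil addr0.
have Qw : Q (ceval lau_p lau_q c *: wp w).
  rewrite -[_ *: _](addKr (ev [seq u <- v | known K u.1])) -ev_split -dv.
  rewrite addrC; apply: QD; first by apply: Qds; rewrite mem_head.
  rewrite -scaleN1r; apply: QZ; apply: veval_submod => // u.
  by rewrite mem_filter => /andP[/QK].
by have := QZ (ceval lau_p lau_q c') _ Qw;
  rewrite scalerA (@cunitVP laurent lau_p lau_q lau_q0 lau_qD _ _ F) scale1r.
Qed.

(** Elements of Q_4 are combinations of images of braids, a braid is the class of a word, and the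
    weights between s_i and t_i are units. *)
Lemma Q4_full (S : Q4 -> Prop) : submod S ->
  (forall u, all (fun x => x < 6)%N u -> S (wp u)) -> forall x, S x.
Proof.
move=> Qs Qw x; have [_ _ QZ] := Qs.
pose pi4 (y : RB 4) : Q4 := (\pi_(Defs.Q 4) y)%qT.
have pi4D : {morph pi4 : y z / y + z} by move=> y z; apply: quot_piD.
have pi40 : pi4 0 = 0 by apply: Q_pi0.
have -> : x = pi4 (repr (x : Defs.Q 4)) by rewrite /pi4 reprK.
move: (repr _) => y; rewrite (monalgE y) (big_morph pi4 pi4D pi40).
apply: submod_sum => // h _.
have -> : pi4 << y@_h *g h >> = y@_h *: pi4 << h >>.
  rewrite [RHS]quot_scale_pi; congr (\pi_(_) _)%qT.
  by rewrite [RHS]gr_scaleE [RHS]gr_mulUU mulr1 mul1g.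
apply: (QZ); pose u := map letter_code (repr h).
have u6 : all (fun x => x < 6)%N u.
  apply/allP => _ /mapP[[i e] _ ->]; rewrite /letter_code /=.
  by case: i e => [[|[|[|//]]] i3] [].
have letterE (i : 'I_3) e : artin_letter 4 (letter_int (letter_code (i, e))) =
    (\pi_(braid_group 4) [:: (i, e)])%qT.
  have i3 := ltn_ord i; rewrite /letter_code /letter_int /=.
  have -> : i = Ordinal i3 by apply: val_inj.
  case: e => /=.
    by rewrite addn0 odd_double doubleK -(artin_ord (n := 4)).
  rewrite addn1 /= odd_double /= uphalf_double.
  apply: etrans (congr1 (fun g => g^-1)%g (artin_ord (n := 4) i3)) _.
  exact: braid_inv_pi.
have hE : artin_word 4 (map letter_int u) = h.
  rewrite -[RHS]reprK artin_wordE /u; elim: (repr h) => [|[i e] s IH] //=.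
  rewrite IH letterE [LHS]braid_mul_pi.
  by [].
have -> : pi4 << h >> = W (map letter_int u) by rewrite /qw /rbw hE.
have := QZ (\prod_(x <- u) letter_scale lau_aV lau_a x) _ (Qw u u6).
rewrite (wprod_scaled _ _ qw4_0 qw4_cat) scalerA letter_scaleK ?scale1r //.
by rewrite mulrC lau_aK.
Qed.
End Closure.

(** * The family of the theorem *)

Section WidenLinear.
Variable n : nat.
Hypothesis n_gt2 : (2 < n)%N.

Lemma Q_widenD (x y : Q n) : Q_widen (x + y) = Q_widen x + Q_widen y.
Proof.
rewrite -[x]reprK -[y]reprK -[_ + _ in LHS]quot_piD !(Q_widen_pi n_gt2).
rewrite group_ring_mapD; exact: quot_piD.
Qed.

Lemma Q_widenZ r (x : Q n) : Q_widen (r *: x) = r *: Q_widen x.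
Proof.
rewrite -[x]reprK [_ *: _ in LHS]quot_scale_pi !(Q_widen_pi n_gt2).
rewrite (group_ring_mapZ (@braid_widenM n)); apply: esym; exact: quot_scale_pi.
Qed.
End WidenLinear.

Section Family.
Local Notation W := (qw 4 : seq int -> Q4).
Local Notation g := (scaled_letter lau_a lau_aV W).
Local Notation wp := (wprod g).
Variable B0 : seq (Q 3).
Hypothesis B0_basis : is_basis B0.

Let P : Q4 -> Prop := spanned (family2 B0 : seq Q4).
Let P_submod : submod P := spanned_submod (family2 B0 : seq Q4).

(** Names the seven segments through equations, so that membership and size can be treated without
    unfolding the products. *)
Lemma family2_cat : exists s0 s1 s2 s3 s4 s5 s6 : seq (Q 4),
  [/\ s0 = [seq Q_widen x | x <- B0], s1 = prods s0 (qws 4 famF2),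
   s2 = prods (qws 4 famE') (qws 4 [:: [:: -3; -2]; [:: -3; -2; 1]]%Z),
   s3 = prods (qws 4 famE0) (qws 4 [:: [:: -3; 2; -1]]%Z) &
   [/\ s4 = prods (qws 4 famE) (qws 4 [:: [:: 3; -2; -1]; [:: 3; 2; -1; 2]]%Z),
   s5 = qws 4 [:: [:: -3; -2; -1]; [:: -3; 2; -1; 2]]%Z, s6 = qws 4 new_words &
   family2 B0 = (s0 ++ s1 ++ s2 ++ s3 ++ s4 ++ s5) ++ s6]].
Proof. by do 7!eexists; split; [..|split; reflexivity]. Qed.

Lemma span_family_mem (y : Q 4) : y \in family2 B0 -> P y.
Proof. exact: spanned_mem. Qed.

Lemma span_letters w : P (W (map letter_int w)) -> P (wp w).
Proof.
move=> Pw; rewrite (wprod_scaled _ _ qw4_0 qw4_cat).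
by case: P_submod => _ _; apply.
Qed.

(** The map from x to [Q_widen x * f] is linear, so the elements of [B0] decide for all of Q_3.
    Through this lemma explicit words in s_1 and s_2 take the place of the unknown basis. *)
Lemma span_widen (f : Q4) : {in B0, forall x, P ((Q_widen x : Q4) * f)} ->
  forall x, P ((Q_widen x : Q4) * f).
Proof.
have [P0 PD PZ] := P_submod.
move=> B0f x; move: x (is_basis_spanned B0_basis x).
apply: (spanned_min _ B0f); split=> [|x y Px Py|r x Px].
- have := PZ 0 (Q_widen 0 * f).
  by rewrite /= -(scale0r (0 : Q 3)) Q_widenZ // scale0r mul0r.
- by rewrite Q_widenD //; rewrite [X in P X]mulrDl; apply: PD.
- by rewrite Q_widenZ // -[X in P X]scalerAl; apply: PZ.
Qed.

Lemma widen_letters w : all (fun x => x < 4)%N w ->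
  W (map letter_int w) = Q_widen (qw 3 (map letter_int w)).
Proof.
move=> w4; apply/esym/Q_widen_qw => //.
rewrite all_map; apply: sub_all w4 => x /=.
by case: x => [|[|[|[|]]]].
Qed.

(** [int_letter] sends both 0 and 1 to the letter 0, so it has to be checked that the words of the
    family survive the translation there and back. *)
Definition faithful_words (U : seq (seq int)) : bool :=
  all (fun u => map letter_int (map int_letter u) == u) U.

Lemma span_words U : faithful_words U -> {in U, forall u, P (W u)} ->
  {in nat_words U, forall w, P (wp w)}.
Proof.
move=> /allP fU UP _ /mapP[u uU ->]; apply: span_letters.
by rewrite (eqP (fU u uU)); apply: UP.
Qed.

Lemma span_wprods (X : seq word) U : faithful_words U ->
  {in X & U, forall x u, P (W (map letter_int x) * W u)} ->
  {in wprods X (nat_words U), forall w, P (wp w)}.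
Proof.
move=> /allP fU XU _ /allpairsP[[x v] /= [xX /mapP[u uU ->] ->]].
apply: span_letters; rewrite map_cat (eqP (fU u uU)) qw4_cat; exact: XU.
Qed.

Lemma span_prods U V : faithful_words U -> faithful_words V ->
  {subset prods (qws 4 U) (qws 4 V) <= family2 B0} ->
  {in wprods (nat_words U) (nat_words V), forall w, P (wp w)}.
Proof.
move=> /allP fU fV sub; apply: span_wprods => // x v /mapP[u uU ->] vV.
rewrite (eqP (fU u uU)); apply: span_family_mem; apply: sub.
by apply: allpairs_f; apply: map_f.
Qed.

Lemma span_family_words (X : seq word) : all (all (fun x => x < 4)%N) X ->
  {in family_words X, forall w, P (wp w)}.
Proof.
move=> /allP X4 w.
have [s0 [s1 [s2 [s3 [s4 [s5 [s6 [e0 e1 e2 e3 [e4 e5 e6 fE]]]]]]]]] := family2_cat.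
have sub i : {subset nth [::] [:: s0; s1; s2; s3; s4; s5; s6] i <= family2 B0}.
  rewrite fE; case: i => [|[|[|[|[|[|[|i]]]]]]] x /=; rewrite ?nth_nil // !mem_cat => ->;
    by rewrite ?orbT.
have sub0 : {subset s0 <= family2 B0} := sub 0%N.
have sub1 : {subset s1 <= family2 B0} := sub 1%N.
have sub2 : {subset s2 <= family2 B0} := sub 2%N.
have sub3 : {subset s3 <= family2 B0} := sub 3%N.
have sub4 : {subset s4 <= family2 B0} := sub 4%N.
have sub5 : {subset s5 <= family2 B0} := sub 5%N.
have sub6 : {subset s6 <= family2 B0} := sub 6%N.
rewrite /family_words mem_cat => /orP[wX|].
  apply: span_letters; rewrite widen_letters ?X4 // -[X in P X]mulr1.
  apply: span_widen => x xB0; rewrite mulr1; apply: span_family_mem.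
  by apply: sub0; rewrite e0; apply: map_f.
rewrite mem_cat => /orP[wX|].
  move: w wX; apply: span_wprods => // x f xX fF.
  rewrite widen_letters ?X4 //; apply: span_widen => y yB0.
  apply: span_family_mem; apply: sub1; rewrite e1 e0.
  by apply: allpairs_f; apply: map_f.
rewrite /family_tail mem_cat => /orP[|].
  by apply: span_prods => //; rewrite -e2.
rewrite mem_cat => /orP[|].
  by apply: span_prods => //; rewrite -e3.
rewrite mem_cat => /orP[|].
  by apply: span_prods => //; rewrite -e4.
rewrite mem_cat => /orP[|].
  apply: span_words => // u uU; apply: span_family_mem; apply: sub5.
  by rewrite e5; apply: map_f.
apply: span_words => // u uU; apply: span_family_mem; apply: sub6.
by rewrite e6; apply: map_f.
Qed.
End Family.

(** * Comparison of the normal words with the family *)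

Section MainTheorem.
Variables (n : nat) (t : trie vec).
Hypothesis t_def : t = complete n steps Leaf [::].
Hypothesis t_check : rules_check n t.
Let ws := normal_words t 8 [:: [::]].
Let basis : seq Q4 := [seq tword w | w <- ws].

Lemma size_normal : size ws = 264%N.
Proof. by case/and5P: t_check => /eqP. Qed.

Lemma spanned_normal v : spanned basis v.
Proof.
apply: Q4_full; first exact: spanned_submod.
apply: (normal_closed t_def t_check); first exact: spanned_submod.
by move=> w wws; rewrite -tword_wprod; apply: spanned_mem; apply: map_f.
Qed.

Lemma free_normal (c : nat -> laurent) :
  \sum_(i < size basis) c i *: basis`_i = 0 ->
  forall i, (i < size basis)%N -> c i = 0.
Proof.
rewrite size_map => c0; apply: (tword_free t_check); rewrite -[RHS]c0.
by apply: eq_bigr => i _; rewrite (nth_map [::]).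
Qed.

Lemma normal_is_basis : is_basis basis.
Proof. exact: spanning_is_basis spanned_normal free_normal spanned_normal. Qed.

(** The count is 20 + 20 * 9 + 8 * 2 + 5 + 8 * 2 + 2 + 25. *)
Lemma size_family2 (B0 : seq (Q 3)) : size B0 = 20%N -> size (family2 B0) = 264%N.
Proof.
move=> B0_20; have [s0 [s1 [s2 [s3 [s4 [s5 [s6]]]]]]] := family2_cat B0.
case=> e0 e1 e2 e3 [e4 e5 e6 ->].
by rewrite !size_cat e1 e2 e3 e4 e5 e6 !size_allpairs !size_map e0 size_map B0_20.
Qed.

Let X := qwords ++ [:: [:: 3; 0; 3]; [:: 3; 1; 3]].
Let K := tabulate (fun=> tt) (family_words X).

Lemma rules_check_saturate :
  all (known K) pivots /\ all (known (saturate n t K pivots)) ws.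
Proof.
have satE : saturation_check n t ws =
  all (known K) pivots && all (known (saturate n t K pivots)) ws by [].
by case/and5P: t_check => _ _ _ _; rewrite -/ws satE => /andP.
Qed.

Lemma spanned_family2 (B0 : seq (Q 3)) : is_basis B0 ->
  forall v, spanned (family2 B0 : seq Q4) v.
Proof.
move=> B0_basis; apply: Q4_full; first exact: spanned_submod.
apply: (normal_closed t_def t_check); first exact: spanned_submod.
have famP := @span_family_words B0 B0_basis X isT.
have [pivK wsK] := rules_check_saturate; move=> w wws.
apply: (saturateP t_def _ _ _ (allP wsK w wws)); first exact: spanned_submod.
  by move=> u; rewrite known_tabulate; apply: famP.
by move=> d /(allP pivK); rewrite known_tabulate; apply: famP.
Qed.

Lemma family2_is_basis (B0 : seq (Q 3)) : size B0 = 20%N -> is_basis B0 ->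
  is_basis (family2 B0).
Proof.
move=> B0_20 B0_basis.
apply: (spanning_is_basis _ spanned_normal free_normal (spanned_family2 B0_basis)).
by rewrite size_map size_normal size_family2.
Qed.
End MainTheorem.

Local Close Scope ring_scope.

Theorem theorem4p10 :
  free_of_rank (Q 4) 264 /\
  (forall B0 : seq (Q 3), size B0 = 20 -> is_basis B0 ->
     size (family2 B0) = 264 /\ is_basis (family2 B0)).
Proof.
have [n [t [t_def t_check]]] := rules_checked; split.
  exists [seq tword w | w <- normal_words t 8 [:: [::]]].
  split; last exact: normal_is_basis t_def t_check.
  by rewrite size_map; apply: size_normal t_check.
move=> B0 B0_20 B0_basis; split; first exact: size_family2.
exact: family2_is_basis t_def t_check _ B0_20 B0_basis.
Qed.
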